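(* Let $n\ge 3$ and $0\le k\le n$ be integers and let $\mu,\nu\in\Pi_{k,n}$. The total number $|\Gamma(\mu,\nu)|$ of dimer configurations on the honeycomb cylinder of circumference $n$ and height $k$ with boundary conditions $b^{in}=b^\mu$ and $b^{out}=b^\nu$ is $$|\Gamma(\mu,\nu)|=\sum_\alpha|\Gamma_\alpha(\mu,\nu)|=\sum_{\lambda\in\Pi_{k,n}}C_{\lambda\mu}^{\nu,d}\prod_{s\in\lambda}\frac{k+c(s)}{h(s)} ,$$ where the first sum is over all $\alpha=(\alpha_1,\dots,\alpha_k)$ with integers $0\le\alpha_i\le n-k$; in the second sum $d=(|\lambda|+|\mu|-|\nu|)/n$ depends on $\lambda$ (the term being $0$ if $d$ is not a nonnegative integer), the product runs over all squares $s=\langle i,j\rangle$ of the Young diagram of $\lambda$, $c(s)=j-i$ is the content of $s$ and $h(s)=\lambda_i+\lambda'_j-i-j+1$ is its hook length.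
   Context: Partitions and binary strings. $\Pi_{k,n}$ is the set of partitions $\mu=(\mu_1\ge\dots\ge\mu_k\ge 0)$ with $\mu_1\le n-k$; $|\mu|=\sum_i\mu_i$; $\lambda'$ is the conjugate partition of $\lambda$. $\Pi_{k,n}$ is identified with the set of binary strings $b=b_n\cdots b_2b_1$ of length $n$ with exactly $k$ one-letters via $\mu\mapsto b^\mu$, where $b^\mu_j=1$ if and only if $j\in\{\mu_{k+1-i}+i : 1\le i\le k\}$. Gromov-Witten invariants. The small quantum cohomology ring of the Grassmannian of $k$-planes in $\mathbb{C}^n$ is $$qH^*(\mathrm{Gr}_k(\mathbb{C}^n))\cong\mathbb{Z}[q][e_1,\dots,e_k]/\langle h_{n-k+1},\dots,h_{n-1},h_n+q(-1)^k\rangle,\qquad h_r=\det(e_{1-i+j})_{1\le i,j\le r},$$ with $e_0=1$ and $e_j=0$ for $j<0$ or $j>k$ (and $h_0=1$, $h_r=0$ for $r<0$). The Schubert classes $\sigma_\lambda=\det(h_{\lambda_i-i+j})_{1\le i,j\le k}$, $\lambda\in\Pi_{k,n}$, form a $\mathbb{Z}[q]$-basis (for $k=0$ the ring is taken to be $\mathbb{Z}[q]$ with basis $\sigma_\emptyset=1$). The (3-point, genus 0) Gromov-Witten invariants $C_{\lambda\mu}^{\nu,d}$ are defined by $\sigma_\mu*\sigma_\lambda=\sum_{d\ge0,\,\nu\in\Pi_{k,n}}q^dC_{\lambda\mu}^{\nu,d}\sigma_\nu$; they vanish unless $|\lambda|+|\mu|=|\nu|+nd$. Lattice. The honeycomb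 lattice on the cylinder with circumference $n$ and height $k$ has rows $t=1,\dots,k$ (numbered from bottom to top); row $t$ is a zigzag cycle of $2n$ vertices $D_{t,j},U_{t,j}$ with $j\in\mathbb{Z}/n\mathbb{Z}$ (representatives $1,\dots,n$). The edges are: edges joining $D_{t,j}$ and $U_{t,j}$; ''horizontal'' edges joining $U_{t,j}$ and $D_{t,j+1}$; vertical edges joining $U_{t,j}$ and $D_{t+1,j}$ for $1\le t\le k-1$; and, in addition, for each $j$ a bottom edge labelled $j$ attached only to $D_{1,j}$ and a top edge labelled $j$ attached only to $U_{k,j}$. Dimers. A dimer configuration (perfect matching) is a set of edges (bottom and top edges may be selected) such that every vertex $D_{t,j},U_{t,j}$ lies on exactly one selected edge. It has boundary conditions $b^{in}=b^\mu$, $b^{out}=b^\nu$ if the bottom edge $j$ is selected iff $b^\mu_j=1$ and the top edge $j$ is selected iff $b^\nu_j=1$. $\Gamma_\alpha(\mu,\nu)$ is the set of dimer configurations with these boundary conditions and exactly $\alpha_t$ selected horizontal edges in row $t$, $t=1,\dots,k$; $\Gamma(\mu,\nu)=\bigcup_\alpha\Gamma_\alpha(\mu,\nu)$ over all $\alpha$ with $0\le\alpha_t\le n-k$. (For $k=0$ there is just the empty matching.) *)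

(* Defs.v *)
From Stdlib Require Import ClassicalEpsilon.
From HB Require Import structures.
From mathcomp Require Import all_boot all_order all_algebra.
From mathcomp Require Import mpoly.

Set Implicit Arguments.
Unset Strict Implicit.
Unset Printing Implicit Defensive.

Import GRing.Theory.
Local Open Scope ring_scope.

(* All indices are shifted to start at 0: the part mu_i is [mu (i - 1)], and the
   lattice row t, column j is [(t - 1, j - 1)].  Differences of indices are
   unaffected. *)

Definition is_part (k n : nat) (mu : {ffun 'I_k -> 'I_(n - k).+1}) : bool :=
  [forall i : 'I_k, forall j : 'I_k, (i <= j)%N ==> (mu j <= mu i)%N].

(* Partitions with at most k parts, all of size at most n - k. *)
Record part (k n : nat) : Type := Part
  { part_val :> {ffun 'I_k -> 'I_(n - k).+1};
    _ : is_part part_val }.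

HB.instance Definition _ k n := [isSub for @part_val k n].
HB.instance Definition _ k n := [Finite of part k n by <:].

Section Partitions.
Variables k n : nat.
Implicit Types (la mu : part k n).

Definition psize mu : nat := (\sum_(i < k) mu i)%N.

Definition conj_part mu (j : nat) : nat := #|[set i : 'I_k | (j < mu i)%N]|.

Definition diagram mu : {set 'I_k * 'I_(n - k)} :=
  [set s : 'I_k * 'I_(n - k) | (s.2 < mu s.1)%N].

Definition content (s : 'I_k * 'I_(n - k)) : int :=
  (s.2 : nat)%:Z - (s.1 : nat)%:Z.

(* With 0-based (i, j), lambda_i + lambda'_j - i - j + 1 becomes
   lambda_i + lambda'_j - (i + 1) - (j + 1) + 1. *)
Definition hook mu (s : 'I_k * 'I_(n - k)) : int :=
  (mu s.1 : nat)%:Z + (conj_part mu s.2)%:Z - (s.1 : nat)%:Z - (s.2 : nat)%:Z - 1.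

(* [rev_ord i] is k - 1 - i, the 0-based version of k + 1 - i. *)
Definition bstring mu (j : 'I_n) : bool :=
  [exists i : 'I_k, (j : nat) == (mu (rev_ord i) + i)%N].

End Partitions.

Section QuantumCohomology.
Variables k n : nat.

(* The ring Z[q][e_1, ..., e_k] is {mpoly {poly int}[k]}: q is the variable of
   {poly int}, and qe m is e_m. *)
Definition qe (m : int) : {mpoly {poly int}[k]} :=
  match m with
  | Posz 0 => 1
  | Posz j.+1 => if (insub j : option 'I_k) is Some i then 'X_i else 0
  | Negz _ => 0
  end.

Definition qh (m : int) : {mpoly {poly int}[k]} :=
  match m with
  | Posz r =>
      \det (\matrix_(i < r, j < r) qe (1 - (i : nat)%:Z + (j : nat)%:Z))
  | Negz _ => 0
  end.

(* The k relations h_(n-k+1), ..., h_(n-1), h_n + q (-1)^k. *)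
Definition qrel (i : 'I_k) : {mpoly {poly int}[k]} :=
  let r := (n - k + i.+1)%N in
  if r == n then qh r%:Z + ('X : {poly int})%:MP * (-1) ^+ k else qh r%:Z.

(* Equality in the quotient ring qH^*(Gr_k(C^n)).  For k = 0 there are no
   relations and the quotient is Z[q]. *)
Definition eq_qH (a b : {mpoly {poly int}[k]}) : Prop :=
  exists c : 'I_k -> {mpoly {poly int}[k]}, a - b = \sum_(i < k) c i * qrel i.

Definition schubert (la : part k n) : {mpoly {poly int}[k]} :=
  \det (\matrix_(i < k, j < k)
          qh ((la i : nat)%:Z - (i : nat)%:Z + (j : nat)%:Z)).

Definition is_schubert_expansion (a : {mpoly {poly int}[k]})
    (c : part k n -> {poly int}) : Prop :=
  eq_qH a (\sum_(nu : part k n) (c nu)%:MP * schubert nu).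

(* The coordinates of a in the Z[q]-basis of Schubert classes, picked by
   definite description: they exist and are unique because the Schubert classes
   form a basis of the quotient. *)
Definition schubert_coord (a : {mpoly {poly int}[k]}) : part k n -> {poly int} :=
  epsilon (inhabits (fun=> 0)) (is_schubert_expansion a).

(* C_{la mu}^{nu, d}: the coefficient of q^d in the nu-coordinate. *)
Definition GW (la mu nu : part k n) (d : nat) : int :=
  (schubert_coord (schubert mu * schubert la) nu)`_d.

End QuantumCohomology.

Inductive vertex (k n : nat) : Type :=
  | Dv of 'I_k & 'I_n
  | Uv of 'I_k & 'I_n.

(* [Inner t j] joins D_{t,j} and U_{t,j}; [Horiz t j] joins U_{t,j} and
   D_{t,j+1}; [Vert l j] is the j-th edge at level l: the bottom edge for l = 0,
   the top edge for l = k, and otherwise the vertical edge between the l-th and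
   the (l+1)-st row from the bottom. *)
Inductive edge (k n : nat) : Type :=
  | Inner of 'I_k & 'I_n
  | Horiz of 'I_k & 'I_n
  | Vert of 'I_k.+1 & 'I_n.

Arguments Dv {k n}.
Arguments Uv {k n}.
Arguments Inner {k n}.
Arguments Horiz {k n}.
Arguments Vert {k n}.

Section EdgeFinite.
Variables k n : nat.

Definition edge_code (e : edge k n) :
    ('I_k * 'I_n) + ('I_k * 'I_n) + ('I_k.+1 * 'I_n) :=
  match e with
  | Inner t j => inl (inl (t, j))
  | Horiz t j => inl (inr (t, j))
  | Vert l j => inr (l, j)
  end.

Definition edge_decode
    (s : ('I_k * 'I_n) + ('I_k * 'I_n) + ('I_k.+1 * 'I_n)) : edge k n :=
  match s with
  | inl (inl (t, j)) => Inner t j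
  | inl (inr (t, j)) => Horiz t j
  | inr (l, j) => Vert l j
  end.

Lemma edge_codeK : cancel edge_code edge_decode.
Proof. by case. Qed.

End EdgeFinite.

HB.instance Definition _ k n := Finite.copy (edge k n) (can_type (@edge_codeK k n)).

Section Dimers.
Variables k n : nat.

(* [ordS] is the cyclic successor on 'I_n. *)
Definition incident (v : vertex k n) (e : edge k n) : bool :=
  match v, e with
  | Dv t j, Inner t' j' => (t' == t) && (j' == j)
  | Dv t j, Horiz t' j' => (t' == t) && (ordS j' == j)
  | Dv t j, Vert l j' => ((l : nat) == t) && (j' == j)
  | Uv t j, Inner t' j' => (t' == t) && (j' == j)
  | Uv t j, Horiz t' j' => (t' == t) && (j' == j)
  | Uv t j, Vert l j' => ((l : nat) == t.+1) && (j' == j)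
  end.

Definition covered_once (M : {set edge k n}) (v : vertex k n) : bool :=
  #|[set e in M | incident v e]| == 1%N.

Definition is_dimer (M : {set edge k n}) : bool :=
  [forall t : 'I_k, forall j : 'I_n,
     covered_once M (Dv t j) && covered_once M (Uv t j)].

Definition has_boundary (mu nu : part k n) (M : {set edge k n}) : bool :=
  [forall j : 'I_n,
     ((Vert ord0 j \in M) == bstring mu j) &&
     ((Vert ord_max j \in M) == bstring nu j)].

Definition nhoriz (M : {set edge k n}) (t : 'I_k) : nat :=
  #|[set j : 'I_n | Horiz t j \in M]|.

Definition Gamma_al (al : {ffun 'I_k -> 'I_(n - k).+1}) (mu nu : part k n) :
    {set {set edge k n}} :=
  [set M : {set edge k n} | [&& is_dimer M, has_boundary mu nu M &
     [forall t : 'I_k, nhoriz M t == al t :> nat]]].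

Definition Gamma (mu nu : part k n) : {set {set edge k n}} :=
  \bigcup_(al : {ffun 'I_k -> 'I_(n - k).+1}) Gamma_al al mu nu.

End Dimers.

(* Main.v *)
(* The quotient ring is studied through its points: over algC, with q = t^n, the
   assignment e_i |-> e_i(x) kills the relations whenever x is a k-tuple of
   distinct n-th roots of (-1)^(k+1) q.  At such a point the bialternant formula
   turns the class of nu into det(x_i^(pos nu a)) / det(x_i^a), where the pos nu a
   are the positions of the ones in the binary string of nu, and the invertibility
   of the Vandermonde matrix of all n roots shows that finitely many such points
   determine the Schubert coordinates.  Rescaling the roots gives the grading.
   A lattice row acts on binary strings by letting every one hop to the right
   without reaching the next one; summing det(x_i^(pos a)) over all hops is a
   telescoping computation with a cyclic bidiagonal matrix, so the row transfer
   matrix has eigenvalue tau = sum_(r <= n-k) h_r(x) and k rows give tau^k.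
   The Cauchy identity at y = (1,...,1) expands tau^k as the sum of
   s_la(1,...,1) s_la(x), and s_la(1,...,1) is given by the hook content formula. *)
Require Import Defs.
From Stdlib Require Import ClassicalEpsilon.
From mathcomp Require Import all_boot all_order all_fingroup all_algebra all_field.
From mathcomp Require Import mpoly.
From mathcomp Require Import zify ring.

Set Implicit Arguments.
Unset Strict Implicit.
Unset Printing Implicit Defensive.

Import GRing.Theory Num.Theory.
Local Open Scope ring_scope.

(** * Determinants and Toeplitz matrices *)

(** [GW] reads off coordinates chosen by [epsilon], which say nothing until some expansion is known
    to exist. This is why spanning is proved: multiplication by e_i raises i rows of a Schubert
    determinant by one index each, and a row that reaches index n is, modulo the relations, a sign
    times q times row 0. Independence in the quotient is not treated separately: evaluation at the
    points pins down every expansion. The sign (-1)^(k+1) is what closes the cylinder up. A one that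
    hops past the last column contributes an extra factor x_i^n, and moving its row to the front is
    a cycle of sign (-1)^(k-1); at q = 1 the two cancel. The count therefore uses q = 1 only, where
    it sees a coordinate summed over all powers of q. Scaling the points by a positive integer t
    changes q = 1 into q = t^n and shows that each coordinate is a single monomial in q or zero, so
    that its value at 1 is the one invariant in the formula. *)

Lemma det_mulmx_sum (R : comNzRingType) k n (A : 'M[R]_(k, n)) (B : 'M_(n, k)) :
  \det (A *m B) = \sum_(f : {ffun 'I_k -> 'I_n})
    (\prod_i A i (f i)) * \det (\matrix_(i, j) B (f i) j).
Proof.
rewrite /determinant.
transitivity (\sum_(s : 'S_k) \sum_(f : {ffun 'I_k -> 'I_n})
   (-1) ^+ s * (\prod_i (A i (f i) * B (f i) (s i)))).
  apply: eq_bigr => s _; under eq_bigr => i _ do rewrite mxE.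
  by rewrite bigA_distr_bigA big_distrr.
rewrite exchange_big; apply: eq_bigr => f _; rewrite big_distrr /=.
apply: eq_bigr => s _; rewrite big_split /= mulrCA; congr (_ * (_ * _)).
by apply: eq_bigr => i _; rewrite mxE.
Qed.

Lemma det_add_rows (R : comNzRingType) k (A B : 'M[R]_k) :
  \det (A + B) = \sum_(S : {set 'I_k})
    \det (\matrix_(i, j) if i \in S then B i j else A i j).
Proof.
rewrite /determinant exchange_big /=; apply: eq_bigr => s _.
rewrite -big_distrr /=; congr (_ * _).
under eq_bigr => i _ do rewrite mxE addrC.
rewrite bigA_distr; apply: eq_bigr => S _.
by apply: eq_bigr => i _; rewrite mxE.
Qed.

Lemma det_rows_nuniq (R : comNzRingType) (T : eqType) k (B : T -> 'I_k -> R) (f : 'I_k -> T) :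
  ~ injective f -> \det (\matrix_(i, j < k) B (f i) j) = 0.
Proof.
move=> ninj; have /injectivePn [i [j ij fij]] : ~~ injectiveb f.
  by apply/negP => /injectiveP.
by apply: (determinant_alternate ij) => l; rewrite !mxE fij.
Qed.

Section Convolution.
Variable R : comNzRingType.
Implicit Types e h : nat -> R.

Lemma sum_window N i j (F : nat -> R) : (i <= j < N)%N ->
  \sum_(l < N) (if (i <= l <= j)%N then F l else 0) =
  \sum_(s < (j - i).+1) F (i + s)%N.
Proof.
case/andP=> ij jN; rewrite -(big_mkord xpredT (fun l => if (i <= l <= j)%N then F l else 0)).
rewrite (big_cat_nat (n := i)) //=; last by rewrite ltnW // (leq_ltn_trans ij).
rewrite big_nat_cond big1 ?add0r; last first.
  by move=> l /andP[/andP[_ li] _]; rewrite leqNgt li.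
rewrite (big_cat_nat (n := j.+1)) //=; last by rewrite ltnW // ltnS.
rewrite [X in _ + X]big_nat_cond [X in _ + X]big1 ?addr0; last first.
  by move=> l /andP[/andP[jl _] _]; rewrite [(l <= j)%N]leqNgt jl andbF.
rewrite -{1}[i]add0n big_addn subSn // big_mkord; apply: eq_bigr => s _.
have -> : (i <= s + i <= j)%N by case: s => s /= hs; lia.
by rewrite addnC.
Qed.

Definition toeplitz e m : 'M[R]_m :=
  \matrix_(i, j) if (i <= j)%N then e (j - i)%N else 0.

Lemma toeplitz_mul e h m : (forall r, \sum_(j < r.+1) e j * h (r - j)%N = (r == 0%N)%:R) ->
  toeplitz e m *m toeplitz h m = 1%:M.
Proof.
move=> eh; apply/matrixP=> i j; rewrite !mxE.
transitivity (\sum_(l < m) if (i <= l <= j)%N then e (l - i)%N * h (j - l)%N else 0).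
  apply: eq_bigr => l _; rewrite !mxE.
  by case: leqP => //= _; rewrite ?mul0r //; case: leqP; rewrite ?mulr0.
have [ij|ji] := leqP i j.
  rewrite (@sum_window m i j (fun l => e (l - i)%N * h (j - l)%N)) ?ij //=.
  transitivity (\sum_(s < (j - i).+1) e s * h ((j - i) - s)%N).
    by apply: eq_bigr => s _; rewrite addKn subnDA.
  rewrite eh; congr (_ %:R); rewrite -val_eqE /=; lia.
rewrite big1 => [|l _]; last by case: ifP => // /andP[? ?]; lia.
rewrite -val_eqE /= (_ : (i == j :> nat) = false) //; lia.
Qed.

Lemma det_toeplitz e m : e 0%N = 1 -> \det (toeplitz e m) = 1.
Proof.
move=> e0; rewrite -det_tr det_trig; last first.
  by apply/is_trig_mxP => i j ij; rewrite !mxE leqNgt ij.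
by rewrite big1 // => i _; rewrite !mxE leqnn subnn.
Qed.

(** Coefficients of the inverse power series. The whole prefix is carried along because each new
    coefficient involves all earlier ones. *)
Fixpoint conv_inv_seq e r : seq R :=
  if r is r'.+1 then
    let s := conv_inv_seq e r' in
    rcons s (- \sum_(j < r) e j.+1 * s`_(r' - j))
  else [:: 1].

Lemma conv_inv_ex e : e 0%N = 1 ->
  exists g : nat -> R, forall r, \sum_(j < r.+1) e j * g (r - j)%N = (r == 0%N)%:R.
Proof.
move=> e0; pose s := conv_inv_seq e; pose g r := (s r)`_r.
have sz r : size (s r) = r.+1 by elim: r => //= r IH; rewrite size_rcons IH.
have st r d : (s (r + d)%N)`_r = g r.
  elim: d => [|d IH]; first by rewrite addn0.
  by rewrite addnS /= nth_rcons sz leq_addr IH.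
exists g => -[|r]; first by rewrite big_ord1 e0 mul1r.
rewrite big_ord_recl subn0 e0 mul1r /g /= nth_rcons sz ltnn eqxx.
rewrite addrC; apply/eqP; rewrite subr_eq0; apply/eqP/eq_bigr => j _.
have jr : (j <= r)%N by rewrite -ltnS.
have := st (r - j)%N j; rewrite (subnK jr) => E.
by rewrite subSS /s /= in E *; congr (_ * _).
Qed.

(** The Jacobi-Trudi determinant det(e_(1-i+j)) that defines h_r, with natural numbers as
    indices. *)
Definition jdet e r : R :=
  \det (\matrix_(i < r, j < r) if (i <= j.+1)%N then e (j.+1 - i)%N else 0).

(* The adjugate of the unitriangular matrix [toeplitz e] is the Toeplitz matrix of
   the inverse series, and its corner entry is [jdet e r] up to sign. *)
Lemma jdet_conv e r : e 0%N = 1 ->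
  \sum_(j < r.+1) (-1) ^+ j * e j * jdet e (r - j)%N = (r == 0%N)%:R.
Proof.
move=> e0; have [g eg] := conv_inv_ex e0.
have gE m : g m = (-1) ^+ m * jdet e m.
  have TG := toeplitz_mul m.+1 eg; have GT := mulmx1C TG.
  have : toeplitz g m.+1 = \adj (toeplitz e m.+1).
    by rewrite -[LHS]mulmx1 -(det_toeplitz m.+1 e0) -mul_mx_adj mulmxA GT mul1mx.
  move/matrixP/(_ ord0 ord_max); rewrite !mxE /= subn0 => ->.
  rewrite /cofactor /= addn0; congr (_ * \det _); apply/matrixP => i j.
  by rewrite !mxE lift_max lift0.
transitivity ((-1) ^+ r * \sum_(j < r.+1) e j * g (r - j)%N); last first.
  by rewrite eg; case: r => [|r]; rewrite ?mulr1 ?mulr0.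
rewrite big_distrr; apply: eq_bigr => j _ /=.
have sg : (-1) ^+ r = (-1) ^+ (r - j) * (-1) ^+ j :> R.
  by rewrite -exprD subnK // -ltnS.
rewrite gE sg; have := sqrr_sign R (r - j); set u := (-1) ^+ (r - j) => u2.
by rewrite -[LHS]mul1r -u2; ring.
Qed.

(* The guard makes h vanish at negative indices in spite of truncated subtraction. *)
Definition shiftrow h (a j : nat) : R := if (j <= a)%N then h (a - j)%N else 0.

End Convolution.

Lemma sum_trunc (V : nmodType) m M (F : nat -> V) : (m <= M)%N ->
  (forall j, (m <= j)%N -> F j = 0) -> \sum_(j < M) F j = \sum_(j < m) F j.
Proof.
move=> mM F0; rewrite -(big_mkord xpredT F) (big_cat_nat (n := m)) //=.
rewrite big_mkord [X in _ + X]big_nat_cond [X in _ + X]big1 ?addr0 //.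
by move=> j /andP[/andP[mj _] _]; apply: F0.
Qed.

Lemma sum_shiftrow (R : comNzRingType) (p : {poly R}) h N a : (size p <= N)%N ->
  \sum_(j < N) p`_j * shiftrow h a j = \sum_(j < a.+1) p`_j * h (a - j)%N.
Proof.
move=> sp.
transitivity (\sum_(j < N + a.+1) p`_j * shiftrow h a j).
  apply/esym/(@sum_trunc _ _ _ (fun j => p`_j * shiftrow h a j)).
    exact: leq_addr.
  by move=> j Nj; rewrite nth_default ?mul0r // (leq_trans sp).
rewrite (@sum_trunc _ a.+1 _ (fun j => p`_j * shiftrow h a j)) ?leq_addl //.
  by apply: eq_bigr => j _; rewrite /shiftrow -ltnS ltn_ord.
by move=> j aj; rewrite /shiftrow leqNgt aj mulr0.
Qed.

(** * Complete symmetric functions at a point *)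

Section Points.
Variables (F : fieldType) (k : nat) (x : 'I_k -> F).

(** Its coefficient of degree j is (-1)^j e_j(x), so the hypothesis [hrec] below says that [h r] is
    the complete symmetric function h_r(x). *)
Definition recip_poly : {poly F} := \prod_(i < k) (1 - x i *: 'X).
Definition recip_poly_but (i : 'I_k) : {poly F} := \prod_(l < k | l != i) (1 - x l *: 'X).

Lemma size_linfactors (P : pred 'I_k) :
  (size (\prod_(l < k | P l) (1 - x l *: 'X))%R <= #|P|.+1)%N.
Proof.
rewrite -sum1_card.
elim/big_rec2: _ => [|i m p _ IH]; first by rewrite size_poly1.
have s2 : (size (1 - x i *: 'X)%R <= 2)%N.
  rewrite (leq_trans (size_polyD _ _)) // size_poly1 size_polyN geq_max /=.
  by rewrite (leq_trans (size_scale_leq _ _)) // size_polyX.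
rewrite (leq_trans (size_polyMleq _ _)) //; lia.
Qed.

Lemma linfactors0 (P : pred 'I_k) : (\prod_(l < k | P l) (1 - x l *: 'X))`_0 = 1.
Proof.
by rewrite coef0_prod big1 // => l _; rewrite coefB coef1 coefZ coefX mulr0 subr0.
Qed.

Lemma recip_polyE i : recip_poly = (1 - x i *: 'X) * recip_poly_but i.
Proof. by rewrite /recip_poly (bigD1 i). Qed.

Lemma size_recip_poly : (size recip_poly <= k.+1)%N.
Proof. by rewrite (leq_trans (size_linfactors _)) // cardT size_enum_ord. Qed.

Lemma size_recip_poly_but i : (size (recip_poly_but i) <= k)%N.
Proof.
rewrite (leq_trans (size_linfactors _)) //.
by have := cardC1 i; rewrite card_ord => ->; case: k i => [[]|].
Qed.

Variable h : nat -> F.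
Hypothesis hrec : forall r, \sum_(j < r.+1) recip_poly`_j * h (r - j)%N = (r == 0%N)%:R.

Lemma hrec0 : h 0%N = 1.
Proof. by have := hrec 0; rewrite big_ord1 linfactors0 mul1r subnn. Qed.

(** The generating series of h is the inverse of [recip_poly]; multiplied by all the linear factors
    but the i-th it leaves 1 / (1 - x_i X), whose coefficients are the powers of x_i. *)
Lemma shiftrow_eigen (i : 'I_k) a :
  \sum_(j < k) shiftrow h a j * (recip_poly_but i)`_j = x i ^+ a.
Proof.
pose S a := \sum_(j < k) (recip_poly_but i)`_j * shiftrow h a j.
transitivity (S a); first by apply: eq_bigr => j _; rewrite mulrC.
elim: a => [|a IH].
  rewrite /S sum_shiftrow ?size_recip_poly_but // big_ord1 subnn hrec0.
  by rewrite linfactors0 mulr1 expr0.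
rewrite exprS -IH; have := hrec a.+1.
rewrite -(@sum_shiftrow _ _ _ k.+1) ?size_recip_poly // (recip_polyE i) /=.
rewrite (eq_bigr (fun j : 'I_k.+1 =>
  (recip_poly_but i)`_j * shiftrow h a.+1 j -
   x i * (if j == 0%N :> nat then 0 else (recip_poly_but i)`_j.-1 * shiftrow h a.+1 j))); last first.
  move=> j _; rewrite mulrBl mul1r -scalerAl coefB coefZ coefXM.
  by case: eqP => _; ring.
rewrite big_split sumrN -big_distrr /= => /eqP; rewrite subr_eq0 => /eqP E.
rewrite /S; move: E; rewrite big_ord_recr /= nth_default ?size_recip_poly_but //.
by rewrite mul0r addr0 => ->; rewrite big_ord_recl /= add0r.
Qed.

Definition eigmx : 'M[F]_k := \matrix_(j, i) (recip_poly_but i)`_j.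

(** The bialternant formula, with [\det eigmx] as denominator. Taking r to be the identity shows
    that this denominator is the Vandermonde determinant. *)
Lemma det_shiftrow (r : 'I_k -> nat) :
  \det (\matrix_(a, j < k) shiftrow h (r a) j) * \det eigmx =
  \det (\matrix_(a, i < k) x i ^+ r a).
Proof.
rewrite -det_mulmx; congr (\det _); apply/matrixP => a i.
rewrite !mxE -shiftrow_eigen; apply: eq_bigr => j _.
by rewrite !mxE.
Qed.

Lemma det_shiftrow_id : \det (\matrix_(a, j < k) shiftrow h a j) = 1.
Proof.
rewrite det_trig; first by rewrite big1 // => i _; rewrite mxE /shiftrow leqnn subnn hrec0.
by apply/is_trig_mxP => i j ij; rewrite !mxE /shiftrow leqNgt ij.
Qed.

Hypothesis x_inj : injective x.

Lemma det_eigmx_neq0 : \det eigmx != 0.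
Proof.
rewrite -[X in X != 0]mul1r -det_shiftrow_id det_shiftrow.
have -> : \matrix_(a, i < k) x i ^+ a = Vandermonde k (\row_i x i).
  by apply/matrixP => a i; rewrite !mxE.
rewrite det_Vandermonde; apply/prodf_neq0 => i _; apply/prodf_neq0 => j ij.
by rewrite !mxE subr_eq0; apply: contraTneq ij => /x_inj ->; rewrite ltnn.
Qed.

Variables (n : nat) (c : F).
Hypotheses (k_le_n : (k <= n)%N) (xn : forall i, x i ^+ n = c).

(** Multiplication by the invertible [eigmx] sends both rows to the constant row c. The entries
    contain all the relations at once: h_n = c and h_(n-j) = 0 for 0 < j < k. *)
Lemma shiftrow_period (j : 'I_k) : shiftrow h n j = c * (j == 0%N :> nat)%:R.
Proof.
have U : eigmx \in unitmx by rewrite unitmxE unitfE det_eigmx_neq0.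
suff /rowP/(_ j) : \row_j shiftrow h n j = \row_(j < k) (c * (j == 0%N :> nat)%:R).
  by rewrite !mxE.
apply: (can_inj (mulmxK U)); apply/rowP => i; rewrite !mxE.
transitivity c.
  rewrite -(xn i) -shiftrow_eigen; apply: eq_bigr => l _.
  by rewrite !mxE.
have := shiftrow_eigen i 0; rewrite expr0 => /(congr1 ( *%R c)); rewrite mulr1 => E.
rewrite -[LHS]E big_distrr; apply: eq_bigr => l _; rewrite !mxE /shiftrow leqn0 /= mulrA.
by case: eqP => _; rewrite ?sub0n ?hrec0. 
Qed.

Lemma h_vanish r : (n - k < r < n)%N -> h r = 0.
Proof.
move=> /andP[r1 r2]; have jk : (n - r < k)%N by lia.
have := shiftrow_period (Ordinal jk); rewrite /shiftrow /= leq_subr subKn ?(ltnW r2) //.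
by rewrite (_ : (n - r == 0)%N = false) ?mulr0 //; lia.
Qed.

Lemma h_period : (0 < k)%N -> h n = c.
Proof.
move=> k0; have := shiftrow_period (Ordinal k0).
by rewrite /shiftrow /= subn0 mulr1.
Qed.

(** Below degree n the truncation changes nothing, because h vanishes strictly between n - k and n.
    In degree n exactly the term h_n = c is missing, and the product has no higher terms. *)
Lemma trunc_gen_mul : (0 < k)%N ->
  (\poly_(r < (n - k).+1) h r) * recip_poly = 1 - c *: 'X^n.
Proof.
move=> k0; set P := \poly_(r < _) _.
have Pc r : (r < n)%N -> P`_r = h r.
  move=> rn; rewrite coef_poly ltnS; case: leqP => // r1.
  by rewrite h_vanish // r1.
apply/polyP => s; rewrite coefMr coefB coef1 coefZ coefXn.
have [sn|ns|->] := ltngtP s n.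
- rewrite mulr0 subr0 -hrec; apply: eq_bigr => j _.
  by rewrite mulrC Pc // (leq_ltn_trans _ sn) // leq_subr.
- rewrite mulr0 subr0 -coefMr nth_default; first by case: s ns.
  have s1 : (size P <= (n - k).+1)%N by apply: size_poly.
  apply: leq_trans (size_polyMleq _ _) _.
  by move: s1 size_recip_poly; move: (size P) (size recip_poly) => a b; lia.
have n0 : (0 < n)%N by lia.
rewrite mulr1; have := hrec n; rewrite !big_ord_recl !subn0 (h_period k0).
rewrite linfactors0 mul1r => E.
rewrite coef_poly (_ : (n < _)%N = false) ?mul0r ?add0r; last by lia.
rewrite (_ : \sum_(i < n) _ = \sum_(i < n) recip_poly`_(bump 0 i) * h (n - bump 0 i)%N).
  by rewrite -E addrAC subrr add0r.
apply: eq_bigr => j _; rewrite mulrC Pc // lift0; have := ltn_ord j; lia.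
Qed.

End Points.

(** * Positions of the ones *)

Definition increasing k (r : 'I_k -> nat) := forall a b : 'I_k, (a < b)%N -> (r a < r b)%N.

Lemma increasing_gap k (r : 'I_k -> nat) (a b : 'I_k) :
  increasing r -> (a <= b)%N -> (r a + (b - a) <= r b)%N.
Proof.
move=> ri ab; have [d db] : exists d, (b - a)%N = d by exists (b - a)%N.
elim: d => [|d IH] in b ab db *.
  by have -> : a = b; [apply: val_inj => /=; lia | rewrite subnn addn0].
have b1k : (b.-1 < k)%N by have := ltn_ord b; lia.
have := IH (Ordinal b1k); have := ri (Ordinal b1k) b; rewrite /=; lia.
Qed.

Lemma increasing_inj k (r : 'I_k -> nat) : increasing r -> injective r.
Proof.
move=> ri a b rab; apply: val_inj => /=.
by case: (ltngtP a b) => // /ri; rewrite rab ltnn.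
Qed.

Lemma increasing_sorted k (r : 'I_k -> nat) :
  increasing r -> sorted ltn [seq r a | a <- enum 'I_k].
Proof.
move=> ri; rewrite sorted_map.
apply: (@sub_sorted _ (relpre val ltn)) => [a b|]; first exact: ri.
by rewrite -sorted_map val_enum_ord iota_ltn_sorted.
Qed.

Lemma increasing_eq k (r s : 'I_k -> nat) : increasing r -> increasing s ->
  (forall a, exists b, r a = s b) -> r =1 s.
Proof.
move=> ri si rs.
have u : uniq [seq r a | a <- enum 'I_k].
  by rewrite map_inj_uniq ?enum_uniq //; apply: increasing_inj.
have sub : {subset [seq r a | a <- enum 'I_k] <= [seq s a | a <- enum 'I_k]}.
  move=> _ /mapP[a _ ->]; have [b ->] := rs a.
  by apply: map_f; rewrite mem_enum.
have sz : (size [seq s a | a <- enum 'I_k] <= size [seq r a | a <- enum 'I_k])%N.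
  by rewrite !size_map.
have [_ eqi] := uniq_min_size u sub sz.
have E := irr_sorted_eq ltn_trans ltnn (increasing_sorted ri) (increasing_sorted si) eqi.
by move=> a; move/eq_in_map: E; apply; rewrite mem_enum.
Qed.

Section Positions.
Variables k n : nat.
Implicit Types (la mu nu : part k n).

(* 0-based and in increasing order; these are the ones of [bstring nu]. *)
Definition pos nu (a : 'I_k) : nat := (nu (rev_ord a) + a)%N.

Lemma part_noninc nu (i j : 'I_k) : (i <= j)%N -> (nu j <= nu i)%N.
Proof. by case: nu => f /= /forallP/(_ i)/forallP/(_ j)/implyP. Qed.

Lemma pos_increasing nu : increasing (pos nu).
Proof.
move=> a b ab; rewrite /pos; have: (nu (rev_ord a) <= nu (rev_ord b))%N.
  apply: part_noninc => /=; lia.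
lia.
Qed.

Hypothesis k_le_n : (k <= n)%N.

Lemma pos_lt nu a : (pos nu a < n)%N.
Proof. have := ltn_ord (nu (rev_ord a)); have := ltn_ord a; rewrite /pos; lia. Qed.

Definition opos nu a : 'I_n := Ordinal (pos_lt nu a).

Lemma opos_inj nu : injective (opos nu).
Proof.
by move=> a b /(congr1 val) /=; apply: increasing_inj; apply: pos_increasing.
Qed.

Lemma pos_eq mu nu : pos mu =1 pos nu -> mu = nu.
Proof.
move=> E; apply/val_inj/ffunP => i; apply: val_inj => /=.
by have := E (rev_ord i); rewrite /pos rev_ordK => /addIn.
Qed.

Lemma ex_part (r : 'I_k -> nat) : increasing r -> (forall a, r a < n)%N ->
  exists nu, pos nu =1 r.
Proof.
move=> ri rn.
have ler (a : 'I_k) : (a <= r a)%N.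
  have k0 : (0 < k)%N by apply: leq_ltn_trans (ltn_ord a).
  by have := increasing_gap ri (leq0n a : (Ordinal k0 <= a)%N); rewrite /=; lia.
have rle (a : 'I_k) : (r a - a < (n - k).+1)%N.
  have k0 : (k.-1 < k)%N by have := ltn_ord a; lia.
  have ak : (a <= Ordinal k0)%N by rewrite /=; have := ltn_ord a; lia.
  by have := increasing_gap ri ak; have := rn (Ordinal k0); rewrite /=; lia.
pose f := [ffun i : 'I_k => Ordinal (rle (rev_ord i))].
have fp : is_part f.
  apply/forallP => i; apply/forallP => j; apply/implyP => ij; rewrite !ffunE /=.
  have ji : (rev_ord j <= rev_ord i)%N by rewrite /=; lia.
  by have := increasing_gap ri ji; have := ler (rev_ord j); rewrite /=; lia.
exists (Part fp) => a; have fa : f (rev_ord a) = (r a - a)%N :> nat.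
  by rewrite ffunE -[in RHS](rev_ordK a).
by rewrite /pos /= fa subnK.
Qed.

Definition pset nu : {set 'I_n} := [set j | bstring nu j].

Lemma pset_image nu : pset nu = [set opos nu a | a : 'I_k].
Proof.
apply/setP => j; rewrite inE; apply/existsP/imsetP => [[a /eqP ja]|[a _ ->]].
  by exists a => //; apply: val_inj.
by exists a.
Qed.

Lemma card_pset nu : #|pset nu| = k.
Proof. by rewrite pset_image card_imset ?card_ord //; apply: opos_inj. Qed.

Lemma pset_inj : injective pset.
Proof.
move=> mu nu E; apply/pos_eq/increasing_eq; try exact: pos_increasing.
move=> a; have : opos mu a \in pset nu by rewrite -E pset_image imset_f.
by rewrite pset_image => /imsetP[b _ /(congr1 val) /= ab]; exists b.
Qed.

Lemma sorted_enum (B : {set 'I_n}) : sorted ltn [seq val j | j <- enum B].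
Proof.
rewrite sorted_map /enum_mem; apply: sorted_filter; first by move=> a b d; apply: ltn_trans.
by rewrite -enumT -sorted_map val_enum_ord iota_ltn_sorted.
Qed.

Lemma ex_part_set (B : {set 'I_n}) : #|B| = k -> exists nu, pset nu = B.
Proof.
move=> Bk; pose s := [seq val j | j <- enum B].
have ss : size s = k by rewrite size_map -cardE.
have [nu nur] : exists nu, pos nu =1 (fun a : 'I_k => nth 0%N s a).
  apply: ex_part => [a b ab|a].
    by apply: (sorted_ltn_nth ltn_trans) ab; rewrite ?inE ?ss ?ltn_ord //; apply: sorted_enum.
  have /(mem_nth 0%N) : (a < size s)%N by rewrite ss.
  by case/mapP => j _ ->; apply: ltn_ord.
exists nu; apply/eqP; rewrite eqEcard card_pset Bk leqnn andbT pset_image.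
apply/subsetP => _ /imsetP[a _ ->].
have /(mem_nth 0%N) : (a < size s)%N by rewrite ss.
rewrite -nur => /mapP[j]; rewrite mem_enum => jB E.
by have -> : opos nu a = j by apply: val_inj.
Qed.

Lemma ex_pos_perm (f : {ffun 'I_k -> 'I_n}) : injective f ->
  exists nu (s : 'S_k), forall i, f i = opos nu (s i).
Proof.
move=> fi.
have [nu nuf] : exists nu, pset nu = [set f i | i : 'I_k].
  by apply: ex_part_set; rewrite card_imset ?card_ord.
have fx i : exists a, opos nu a == f i.
  have : f i \in pset nu by rewrite nuf imset_f.
  by rewrite pset_image => /imsetP[a _ ->]; exists a.
have u_inj : injective (fun i => xchoose (fx i)).
  move=> i j E; apply: fi.
  by rewrite -(eqP (xchooseP (fx i))) -(eqP (xchooseP (fx j))) E.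
exists nu, (perm u_inj) => i; rewrite permE /=.
exact/esym/eqP/(xchooseP (fx i)).
Qed.

(** An injective f factors uniquely as a permutation followed by the increasing enumeration of its
    image, and the k-element images are exactly the position sets of partitions. *)
Lemma sum_over_positions (V : nmodType) (G : {ffun 'I_k -> 'I_n} -> V) :
  (forall f : {ffun 'I_k -> 'I_n}, ~ injective f -> G f = 0) ->
  \sum_f G f = \sum_(nu : part k n) \sum_(s : 'S_k) G [ffun i => opos nu (s i)].
Proof.
move=> G0; rewrite (bigID (fun f : {ffun 'I_k -> 'I_n} => injectiveb f)) /=.
rewrite [X in _ + X]big1 ?addr0; last by move=> f /injectiveP/G0.
pose t (p : part k n * 'S_k) : {ffun 'I_k -> 'I_n} := [ffun i => opos p.1 (p.2 i)].
have t_inj : injective t.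
  move=> [mu s] [nu u] /ffunP E.
  have Ei i : opos mu (s i) = opos nu (u i) by have := E i; rewrite !ffunE.
  have mn : mu = nu.
    apply/pos_eq/increasing_eq; try exact: pos_increasing.
    move=> a; exists (u ((s^-1)%g a)).
    by have /(congr1 val) := Ei ((s^-1)%g a); rewrite permKV.
  rewrite mn; congr (_, _); apply/permP => i; apply: (@opos_inj nu).
  by rewrite -mn Ei mn.
rewrite pair_big_dep /= -(big_imset _ (in2W t_inj)) /=; apply: eq_bigl => f.
apply/injectiveP/imsetP => [fi|[[mu s] _ ->]]; last first.
  by move=> i j; rewrite !ffunE => /opos_inj /perm_inj.
by have [nu [s fE]] := ex_pos_perm fi; exists (nu, s) => //; apply/ffunP => i; rewrite ffunE.
Qed.

End Positions.

Lemma card_ord_ltn k m : (m <= k)%N -> #|[set l : 'I_k | (l < m)%N]| = m.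
Proof.
move=> mk; rewrite -sum1_card; under eq_bigl do rewrite inE.
by rewrite -(big_ord_widen k (fun=> 1%N) mk) sum1_card card_ord.
Qed.

Lemma card_ord_gtn k (i : 'I_k) : #|[set l : 'I_k | (i < l)%N]| = (k - i.+1)%N.
Proof.
have -> : [set l : 'I_k | (i < l)%N] = ~: [set l : 'I_k | (l < i.+1)%N].
  by apply/setP => l; rewrite !inE ltnS ltnNge.
by rewrite cardsCs setCK card_ord_ltn // card_ord.
Qed.

(** * Determinants of binomial coefficients *)

Section Binomials.

Definition ffact_poly i : {poly int} := \prod_(l < i) ('X - (l%:R)%:P).

Lemma size_ffact_poly i : size (ffact_poly i) = i.+1.
Proof. by rewrite size_prod_XsubC /index_enum -enumT size_enum_ord. Qed.

Lemma ffact_poly_monic i : ffact_poly i \is monic.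
Proof. exact: monic_prod_XsubC. Qed.

Lemma ffact_polyE i r : (ffact_poly i).[r%:R] = (r ^_ i)%:R.
Proof.
rewrite /ffact_poly horner_prod ffact_prod natr_prod.
have [ir|ri] := leqP i r.
  apply: eq_bigr => l _; rewrite !hornerE natrB //; have := ltn_ord l; lia.
rewrite (bigD1 (Ordinal ri)) //= !hornerE subrr mul0r.
by rewrite (bigD1 (Ordinal ri)) //= subnn mul0r.
Qed.

(** i! C(r, i) is the value at r of a monic polynomial of degree i. Hence scaling the columns by i!
    gives the Vandermonde matrix times a unitriangular one. *)
Lemma det_binomials k (r : 'I_k -> nat) :
  \det (\matrix_(a, i < k) ('C(r a, i)%:R : int)) * \prod_(i < k) (i`!)%:R =
  \prod_(i < k) \prod_(j < k | (i < j)%N) ((r j)%:R - (r i)%:R).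
Proof.
pose Q : 'M[int]_k := \matrix_(j, i) (ffact_poly i)`_j.
have detQ : \det Q = 1.
  rewrite -det_tr det_trig; last first.
    by apply/is_trig_mxP => i j ij; rewrite !mxE nth_default // size_ffact_poly.
  rewrite big1 // => i _; rewrite !mxE.
  by have /monicP := ffact_poly_monic i; rewrite lead_coefE size_ffact_poly.
transitivity (\det (Vandermonde k (\row_i (r i)%:R : 'rV[int]_k))); last first.
  rewrite det_Vandermonde; apply: eq_bigr => i _; apply: eq_bigr => j _.
  by rewrite !mxE.
rewrite -[RHS]mulr1 -[X in _ = _ * X]detQ.
transitivity (\det ((\matrix_(a, i < k) ('C(r a, i)%:R : int)) *m diag_mx (\row_(i < k) (i`!)%:R))).
  rewrite det_mulmx det_diag; congr (_ * _).
  by apply: eq_bigr => i _; rewrite mxE.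
rewrite -[X in _ = X * _]det_tr -det_mulmx; congr (\det _).
apply/matrixP => a i; rewrite mul_mx_diag !mxE -natrM bin_ffact -ffact_polyE.
rewrite (@horner_coef_wide _ k) ?size_ffact_poly //.
by apply: eq_bigr => j _; rewrite !mxE mulrC.
Qed.

End Binomials.

(** * Cauchy identity and hook content formula at (1, ..., 1) *)

Section Cauchy.
Variables (k n : nat).
Hypothesis k_le_n : (k <= n)%N.

(** The value s_la(1, ..., 1): in the confluent limit of the bialternant quotient, column i becomes
    the i-th Taylor coefficients of the powers at 1, and the denominator becomes 1. *)
Definition schur1 (la : part k n) : int := \det (\matrix_(a, i < k) 'C(pos la a, i)%:R).

(* Cauchy-Binet for the coefficients of u^i in P(1+u) (1+u)^j, with P the generating
   polynomial of h: this replaces k equal values by k derivatives at 1. *)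
Lemma cauchy_ones (R : comNzRingType) (h : nat -> R) :
  (forall r, (n - k < r < n)%N -> h r = 0) ->
  (\sum_(r < (n - k).+1) h r) ^+ k =
  \sum_(la : part k n) (schur1 la)%:~R * \det (\matrix_(a, j < k) shiftrow h (pos la a) j).
Proof.
move=> h0.
pose L : 'M[R]_(k, n) := \matrix_(i, r) ('C(r, i))%:R.
pose H : 'M[R]_(n, k) := \matrix_(r, j) shiftrow h r j.
(* [p m] is the m-th Taylor coefficient of P at 1, so [T] is multiplication by P(1+u) and column j
   of [B] lists the coefficients of (1+u)^j. *)
pose p m := \sum_(s < (n - k).+1) h s * ('C(s, m))%:R.
pose T : 'M[R]_k := \matrix_(i, l) if (l <= i)%N then p (i - l)%N else 0.
pose B : 'M[R]_k := \matrix_(l, j) ('C(j, l))%:R.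
have LH : L *m H = T *m B.
  apply/matrixP => i j; rewrite !mxE.
  pose h' s := if (s <= n - k)%N then h s else 0.
  have hh' s : (s < n)%N -> h s = h' s.
    by move=> sn; rewrite /h'; case: leqP => // ?; apply: h0; apply/andP.
  transitivity (\sum_(s < (n - k).+1) 'C(j + s, i)%:R * h s).
    transitivity (\sum_(r < n) if (j <= r <= n.-1)%N then 'C(r, i)%:R * h' (r - j)%N else 0).
      apply: eq_bigr => r _; rewrite !mxE /shiftrow.
      have -> : (r <= n.-1)%N by have := ltn_ord r; lia.
      case: leqP => /= _; last by rewrite mulr0.
      by rewrite hh' // (leq_ltn_trans (leq_subr _ _)).
    have jn : (j <= n.-1 < n)%N by have := ltn_ord j; lia.
    rewrite (@sum_window R n j n.-1 (fun r => 'C(r, i)%:R * h' (r - j)%N)) //.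
    rewrite (@sum_trunc _ (n - k).+1 _ (fun s => 'C(j + s, i)%:R * h' (j + s - j)%N)).
    - by apply: eq_bigr => s _; rewrite addKn /h' -ltnS ltn_ord.
    - by have := ltn_ord j; lia.
    - by move=> s ms; rewrite addKn /h' leqNgt ms mulr0.
  transitivity (\sum_(l < i.+1) p (i - l)%N * 'C(j, l)%:R); last first.
    transitivity (\sum_(l < k) (if (l <= i)%N then p (i - l)%N else 0) * 'C(j, l)%:R); last first.
      by apply: eq_bigr => l _; rewrite !mxE.
    rewrite (@sum_trunc _ i.+1 k (fun l => (if (l <= i)%N then p (i - l)%N else 0) * 'C(j, l)%:R)) //.
      by apply: eq_bigr => l _; rewrite -ltnS ltn_ord.
    by move=> l il; rewrite leqNgt il mul0r.
  under [RHS]eq_bigr => l _ do rewrite big_distrl.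
  rewrite exchange_big; apply: eq_bigr => s _ /=.
  rewrite -binomial.Vandermonde natr_sum big_distrl; apply: eq_bigr => l _ /=.
  by rewrite natrM; ring.
have detT : \det T = (\sum_(r < (n - k).+1) h r) ^+ k.
  rewrite det_trig; last by apply/is_trig_mxP => i j ij; rewrite !mxE leqNgt ij.
  transitivity (\prod_(i < k) (\sum_(r < (n - k).+1) h r)).
    apply: eq_bigr => i _; rewrite !mxE leqnn subnn.
    by apply: eq_bigr => s _; rewrite bin0 mulr1.
  by rewrite prodr_const card_ord.
have detB : \det B = 1.
  rewrite -det_tr det_trig; last by apply/is_trig_mxP => i j ij; rewrite !mxE bin_small.
  by rewrite big1 // => i _; rewrite !mxE binn.
rewrite -detT -[LHS]mulr1 -[X in _ * X = _]detB -det_mulmx -LH det_mulmx_sum.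
rewrite (sum_over_positions k_le_n); last first.
  move=> f nf; rewrite [X in _ * X](_ : _ = 0) ?mulr0 //.
  rewrite -(det_rows_nuniq (fun r : 'I_n => shiftrow h r) nf).
  by congr (\det _); apply/matrixP => i j; rewrite !mxE.
apply: eq_bigr => la _.
have -> : schur1 la = \sum_(s : 'S_k) (-1) ^+ s * \prod_i 'C(pos la (s i), i)%:R.
  rewrite /schur1 -det_tr; apply: eq_bigr => s _; congr (_ * _).
  by apply: eq_bigr => i _; rewrite !mxE.
rewrite rmorph_sum big_distrl.
apply: eq_bigr => s _ /=; rewrite rmorphM rmorph_sign rmorph_prod [RHS]mulrAC [RHS]mulrC /=.
congr (_ * _).
  by apply: eq_bigr => i _; rewrite !mxE ffunE /= rmorph_nat.
transitivity (\det (perm_mx s *m \matrix_(a, j < k) shiftrow h (pos la a) j)).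
  by rewrite -row_permE; congr (\det _); apply/matrixP => i j; rewrite !mxE ffunE.
by rewrite det_mulmx det_perm.
Qed.

End Cauchy.

Section HookContent.
Variables (k n : nat) (la : part k n).

Definition shifted_part (i : 'I_k) : nat := (la i + (k - i.+1))%N.

Lemma pos_rev i : pos la (rev_ord i) = shifted_part i.
Proof. by rewrite /pos rev_ordK. Qed.

Lemma shifted_part_lt (i l : 'I_k) : (i < l)%N -> (shifted_part l < shifted_part i)%N.
Proof.
by move=> il; rewrite -!pos_rev; apply: pos_increasing => /=; have := ltn_ord l; lia.
Qed.

Lemma conj_part_gt (i : 'I_k) j : (i < conj_part la j)%N = (j < la i)%N.
Proof.
apply/idP/idP => [|ji]; last first.
  rewrite -[X in (X <= _)%N](card_ord_ltn (ltn_ord i)).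
  apply/subset_leq_card/subsetP => l; rewrite !inE => li.
  by apply: leq_trans ji (part_noninc _ _); rewrite -ltnS.
apply: contraLR; rewrite -!leqNgt => ij.
rewrite -[X in (_ <= X)%N](card_ord_ltn (ltnW (ltn_ord i))).
apply/subset_leq_card/subsetP => l; rewrite !inE; apply: contraLR.
by rewrite -!leqNgt => /(part_noninc la) li; apply: leq_trans ij.
Qed.

(** For j < la_i the conjugate part exceeds i, so no subtraction is truncated there. *)
Definition hookn (i : 'I_k) (j : nat) : nat := (la i - j + conj_part la j - i.+1)%N.

Lemma hooknE (s : 'I_k * 'I_(n - k)) : (s.2 < la s.1)%N -> hook la s = (hookn s.1 s.2)%:Z.
Proof.
by move=> h; have := h; rewrite -conj_part_gt /hook /hookn; move: (conj_part _ _) => c; lia.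
Qed.

Lemma row_content i :
  (\prod_(j < n - k | j < la i) (k + j - i) * (k - i.+1)`! = (shifted_part i)`!)%N.
Proof.
have lai : (la i <= n - k)%N by rewrite -ltnS.
rewrite -(big_ord_widen (n - k) (fun j => k + j - i)%N lai) /shifted_part.
elim: (la i : nat) => [|m IH]; first by rewrite big_ord0 mul1n.
rewrite big_ord_recr /= mulnAC IH addSn factS mulnC; congr (_ * _)%N.
by have := ltn_ord i; lia.
Qed.

(* The hooks of row i together with the differences of shifted parts are exactly
   the integers from 1 to [shifted_part i]. *)
Lemma row_hook i :
  (\prod_(j < n - k | j < la i) hookn i j *
   \prod_(l < k | i < l) (shifted_part i - shifted_part l) = (shifted_part i)`!)%N.
Proof.
have lai : (la i <= n - k)%N by rewrite -ltnS.
rewrite -(big_ord_widen (n - k) (hookn i) lai).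
pose s1 := [seq hookn i j | j <- iota 0 (la i)].
pose s2 := [seq (shifted_part i - shifted_part l)%N | l : 'I_k <- enum 'I_k & (i < l)%N].
have hk j : (j < la i)%N -> (0 < hookn i j)%N /\ (hookn i j + j + i.+1 = la i + conj_part la j)%N.
  by move=> ji; have := ji; rewrite -conj_part_gt /hookn; lia.
have conj_le j : (conj_part la j <= k)%N.
  by rewrite -[X in (_ <= X)%N](card_ord k) max_card.
have conj_mono j j' : (j <= j')%N -> (conj_part la j' <= conj_part la j)%N.
  move=> jj; apply/subset_leq_card/subsetP => l; rewrite !inE; exact: leq_ltn_trans.
have s1_sorted (j j' : nat) : (j < la i)%N -> (j' < la i)%N -> hookn i j = hookn i j' -> j = j'.
  move=> /hk[_ h1] /hk[_ h2] E.
  by case: (ltngtP j j') => // jj; have := conj_mono _ _ (ltnW jj); lia.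
have u : uniq (s1 ++ s2).
  rewrite cat_uniq; apply/and3P; split.
  - rewrite map_inj_in_uniq ?iota_uniq // => j j'; rewrite !mem_iota /= !add0n.
    exact: s1_sorted.
  (* A hook in column j equal to the difference for l would give la'_j - l = j + 1 - la_l. By
     [conj_part_gt] the left side is positive exactly when j < la_l, that is, when the right side is
     not. *)
  - apply/hasPn => m /mapP[l]; rewrite mem_filter => /andP[il _] ->.
    apply/mapP => -[j]; rewrite mem_iota add0n => /andP[_ ji] E.
    have [h0 h1] := hk j ji; have sl := shifted_part_lt il.
    have := conj_part_gt l j; move: E sl h1 h0; rewrite /shifted_part.
    have := ltn_ord l; have := il; move: (conj_part la j) (hookn i j) => c h.
    by case: ltnP => lc; case: ltnP => ll //; lia.
  - rewrite map_inj_in_uniq; first by apply: filter_uniq; apply: enum_uniq.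
    move=> l l'.
    rewrite !mem_filter => /andP[il _] /andP[il' _] E; apply: val_inj => /=.
    move: (shifted_part_lt il) (shifted_part_lt il') E.
    by case: (ltngtP l l') => // /shifted_part_lt; lia.
have sub : {subset s1 ++ s2 <= iota 1 (shifted_part i)}.
  move=> m; rewrite mem_cat mem_iota add1n ltnS => /orP[] /mapP[j].
    rewrite mem_iota add0n /= => ji ->; have [h0 h1] := hk j ji.
    by rewrite h0 /= /shifted_part; have := conj_le j; lia.
  by rewrite mem_filter => /andP[ij _] ->; have := shifted_part_lt ij; lia.
have sz : (size (iota 1 (shifted_part i)) <= size (s1 ++ s2))%N.
  rewrite size_iota size_cat !size_map size_iota leq_add2l size_filter.
  rewrite -(card_ord_gtn i) cardE size_filter -enumT.
  by rewrite (eq_count (a2 := fun l : 'I_k => (i < l)%N)) // => l; rewrite !inE.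
have [_ mem_eq] := uniq_min_size u sub sz.
have pe := uniq_perm u (iota_uniq _ _) mem_eq.
have -> : (shifted_part i)`! = (\prod_(m <- iota 1 (shifted_part i)) m)%N.
  by rewrite fact_prod /index_iota subn1.
rewrite -(perm_big _ pe) big_cat !big_map big_filter /=; congr (_ * _)%N.
  by rewrite -[in RHS](subn0 (la i)) big_mkord.
by rewrite big_enum_cond.
Qed.

(** By [row_content] and [row_hook], row i contributes its differences of shifted parts divided by
    (k - i - 1)!. Over all rows this is the difference product over factorials by which
    [det_binomials] evaluates [schur1]. *)
Lemma hook_content : \prod_(s in diagram la) ((k%:Z + content s)%:~R / (hook la s)%:~R) =
  (schur1 la)%:~R :> rat.
Proof.
have fact_neq0 m : (m`!)%:R != 0 :> rat by rewrite pnatr_eq0 -lt0n fact_gt0.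
pose G (i : 'I_k) (j : 'I_(n - k)) : rat := (k + j - i)%N%:R / (hookn i j)%:R.
transitivity (\prod_(i < k) \prod_(j < n - k | (j < la i)%N) G i j).
  rewrite pair_big_dep /=; apply: eq_big => [s|s]; rewrite inE //.
  move=> h; rewrite (hooknE h) /G /=.
  have -> : k%:Z + content s = (k + s.2 - s.1)%N%:Z.
    by rewrite /content; have := ltn_ord s.1; lia.
  by rewrite -!pmulrn.
pose D (i : 'I_k) : rat := \prod_(l < k | (i < l)%N) (shifted_part i - shifted_part l)%N%:R.
transitivity (\prod_(i < k) (D i / ((k - i.+1)`!)%:R)).
  apply: eq_bigr => i _; rewrite big_split prodfV /= -!natr_prod.
  have := row_hook i; have := row_content i; move: (\prod_(j < _ | _) _)%N => a.
  move: (\prod_(j < _ | _) _)%N => b; rewrite /D -natr_prod.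
  move: (\prod_(j < _ | _) _)%N => c ak bc.
  have := fact_neq0 (shifted_part i); rewrite -{1}bc natrM mulf_eq0 negb_or => /andP[b0 c0].
  have /(congr1 (fun m => m%:R : rat)) : (a * (k - i.+1)`! = b * c)%N by rewrite ak bc.
  rewrite !natrM => E.
  by apply/eqP; rewrite eqr_div // ?fact_neq0 // E mulrC.
rewrite big_split prodfV /=.
have fr : \prod_(i < k) ((k - i.+1)`!)%:R = \prod_(i < k) (i`!)%:R :> rat.
  by rewrite (reindex_inj rev_ord_inj) /=; apply: eq_bigr => i _; rewrite -[in RHS](rev_ordK i).
have f0 : \prod_(i < k) (i`!)%:R != 0 :> rat by apply/prodf_neq0 => i _.
rewrite fr; apply: (canLR (mulfK f0)).
have /(congr1 (fun m => m%:~R : rat)) := det_binomials (pos la).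
rewrite rmorphM !rmorph_prod /= => E.
have -> : \prod_(i < k) (i`!)%:R = \prod_(i < k) ((i`!)%:R : int)%:~R :> rat.
  by apply: eq_bigr => i _; rewrite rmorph_nat.
rewrite E [RHS](reindex_inj rev_ord_inj) /=.
transitivity (\prod_(i < k) \prod_(l < k | (l < i)%N) (shifted_part l - shifted_part i)%N%:R : rat).
  by rewrite (exchange_big_dep xpredT) //=; apply: eq_bigr => i _; rewrite /D.
apply: eq_bigr => i _; rewrite rmorph_prod [RHS](reindex_inj rev_ord_inj) /=.
apply: eq_big => [l|l li]; first by have := ltn_ord l; have := ltn_ord i; lia.
rewrite !pos_rev natrB; last exact: ltnW (shifted_part_lt li).
by rewrite rmorphB !rmorph_nat.
Qed.

End HookContent.

(** * One row of the lattice *)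

Section Transfer.
Variable n : nat.
Implicit Types B H : {set 'I_n}.

(* B is the set of selected vertical edges below a row, H the set of its selected
   horizontal edges; the inner edges and the vertical edges above are then forced. *)
Definition row_valid B H : bool :=
  [forall j : 'I_n, ~~ ((ord_pred j \in H) && (j \in B)) &&
     ((j \in H) ==> (j \in B) || (ord_pred j \in H))].

Definition row_out B H : {set 'I_n} :=
  [set j : 'I_n | ((j \in B) || (ord_pred j \in H)) && (j \notin H)].

Variable k' : nat.
Local Notation k := k'.+1.
Variable p : 'I_k -> nat.
Hypotheses (p_incr : increasing p) (p_lt : forall a, (p a < n)%N).

(* Positions are unrolled: the last one is followed by the first one plus n. *)
Definition next_pos (a : 'I_k) : nat :=
  if insub a.+1 is Some b then p b else (p ord0 + n)%N.

Lemma next_pos_lift (a : 'I_k') : next_pos (lift ord_max a) = p (lift ord0 a).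
Proof.
rewrite /next_pos insubT => [|lt]; first by rewrite lift_max ltnS.
by congr p; apply: val_inj => /=; rewrite /bump leqNgt ltn_ord.
Qed.

Lemma next_pos_max : next_pos ord_max = (p ord0 + n)%N.
Proof. by rewrite /next_pos insubF //= ltnn. Qed.

Lemma next_posP (a : 'I_k) :
  (exists2 b : 'I_k, b = a.+1 :> nat & next_pos a = p b) \/
  (a = ord_max /\ next_pos a = (p ord0 + n)%N).
Proof.
have [<-|/unlift_some[b -> _]] := eqVneq ord_max a; last first.
  left; exists (lift ord0 b); last by rewrite next_pos_lift.
  by rewrite lift_max lift0.
by right; rewrite next_pos_max.
Qed.

Lemma p_mono (a b : 'I_k) : (a <= b)%N -> (p a <= p b)%N.
Proof. by move/(increasing_gap p_incr); lia. Qed.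

Lemma next_pos_gt a : (p a < next_pos a)%N.
Proof.
case: (next_posP a) => [[b ba ->]|[-> ->]]; first by apply: p_incr; rewrite ba.
by rewrite ltn_addl.
Qed.

Lemma next_pos_le a : (next_pos a <= p ord0 + n)%N.
Proof.
case: (next_posP a) => [[b ba ->]|[_ ->]] //.
by rewrite ltnW // ltn_addl.
Qed.

Lemma next_pos_lt2 a : (next_pos a < n + n)%N.
Proof. by apply: leq_ltn_trans (next_pos_le a) _; rewrite ltn_add2r. Qed.

Lemma n_gt0 : (0 < n)%N.
Proof. exact: leq_ltn_trans (p_lt ord0). Qed.

Definition wrap (u : nat) : 'I_n := Ordinal (ltn_pmod u n_gt0).

Lemma ord_pred_wrap u : ord_pred (wrap u.+1) = wrap u.
Proof.
apply: val_inj => /=; have n0 := n_gt0.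
have -> : ((u.+1 %% n + n).-1 = u.+1 %% n + n.-1)%N by lia.
rewrite modnDml (_ : u.+1 + n.-1 = u + n)%N; last by lia.
by rewrite modnDr.
Qed.

Definition in_gap (a : 'I_k) u := (p a <= u < next_pos a)%N.

Lemma wrapE a u : in_gap a u -> u = wrap u \/ u = (wrap u + n)%N.
Proof.
move=> /andP[_ un]; have u2 := ltn_trans un (next_pos_lt2 a); rewrite /=.
have [ltun|leun] := ltnP u n; [left|right]; first by rewrite modn_small.
rewrite -[in RHS](subnK leun) modnDr modn_small ?subnK //; lia.
Qed.

Lemma gap_lt (a b : 'I_k) u v : (a < b)%N -> in_gap a u -> in_gap b v -> (u < v)%N.
Proof.
move=> ab /andP[_ ua] /andP[bv _]; apply: leq_trans ua (leq_trans _ bv).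
case: (next_posP a) => [[c ca ->]|[am _]]; first by apply: p_mono; rewrite ca.
by move: ab; rewrite am /= ltnNge -ltnS ltn_ord.
Qed.

Lemma gap_uniq a b u v : in_gap a u -> in_gap b v -> wrap u = wrap v -> a = b /\ u = v.
Proof.
move=> ua vb E.
have uv : u = v.
  have [/andP[pu un] /andP[pv vn]] := (ua, vb).
  have := next_pos_le a; have := next_pos_le b.
  have := p_mono (leq0n a : (ord0 <= a)%N); have := p_mono (leq0n b : (ord0 <= b)%N).
  case: (wrapE ua) (wrapE vb); rewrite E; move: (wrap v : nat) => w; lia.
split=> //; apply: val_inj; case: (ltngtP a b) => // ab.
  by have := gap_lt ab ua vb; rewrite uv ltnn.
by have := gap_lt ab vb ua; rewrite uv ltnn.
Qed.

(** The gaps are consecutive and fill exactly one period, from [p ord0] up to [p ord0 + n]. *)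
Lemma gap_ex j : exists a u, in_gap a u /\ wrap u = j.
Proof.
suff gap u : (p ord0 <= u < p ord0 + n)%N -> exists a, in_gap a u.
  have [pj|jp] := leqP (p ord0) j.
    have [|a ja] := gap j; first by rewrite pj ltn_addl.
    by exists a, j; split=> //; apply: val_inj; rewrite /= modn_small.
  (* A column to the left of the first one is reached only by wrapping around. *)
  have [|a ja] := gap (j + n)%N.
    by rewrite ltn_add2r jp (leq_trans (ltnW (p_lt _))) ?leq_addl.
  by exists a, (j + n)%N; split=> //; apply: val_inj; rewrite /= modnDr modn_small.
move=> /andP[u1 u2].
pose a := [arg max_(a > ord0 | (p a <= u)%N) (a : nat)].
have : [arg max_(a > ord0 | (p a <= u)%N) (a : nat)] = a by [].
case: arg_maxnP => // b pb bmax _; exists b; rewrite /in_gap pb /=.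
case: (next_posP b) => [[c cb ->]|[_ ->]] //.
by rewrite ltnNge; apply/negP => /bmax /=; lia.
Qed.

Definition pos_set : {set 'I_n} := [set j : 'I_n | [exists a, p a == j]].

Lemma in_pos_set a u : in_gap a u -> (wrap u \in pos_set) = (u == p a).
Proof.
have pw b : wrap (p b) = p b :> nat by rewrite /= modn_small.
have gb b : in_gap b (p b) by rewrite /in_gap leqnn next_pos_gt.
move=> ua; rewrite inE; apply/existsP/eqP => [[b /eqP pb]|->]; last by exists a; rewrite pw.
have E : wrap u = wrap (p b) by apply: val_inj; rewrite [RHS]pw pb.
by have [-> ->] := gap_uniq ua (gb b) E.
Qed.

Lemma wrap_next a : wrap (next_pos a) \in pos_set.
Proof.
rewrite inE; apply/existsP.
case: (next_posP a) => [[b _ ->]|[_ ->]]; first by exists b; rewrite /= modn_small.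
by exists ord0; rewrite /= modnDr modn_small.
Qed.

Definition in_gaps (f : {ffun 'I_k -> 'I_(n + n)}) := [forall a, in_gap a (f a)].

(* The one at p a hops to f a, along the horizontal edges p a, ..., f a - 1. *)
Definition hop_set (f : {ffun 'I_k -> 'I_(n + n)}) : {set 'I_n} :=
  [set j : 'I_n | [exists a, (p a <= j < f a)%N || (p a <= j + n < f a)%N]].

Section HopSet.
Variable f : {ffun 'I_k -> 'I_(n + n)}.
Hypothesis fP : in_gaps f.

Let fgap a : in_gap a (f a). Proof. exact: (forallP fP). Qed.

Lemma gap_below a u : (p a <= u < f a)%N -> in_gap a u.
Proof.
move=> /andP[pu uf]; rewrite /in_gap pu; apply: ltn_trans uf _.
by case/andP: (fgap a).
Qed.

Lemma in_hop_set a u : in_gap a u -> (wrap u \in hop_set f) = (u < f a)%N.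
Proof.
move=> ua; rewrite inE; apply/existsP/idP => [[b]|uf].
  have w0 : wrap (wrap u) = wrap u by apply: val_inj; rewrite /= modn_mod.
  have w1 : wrap (wrap u + n) = wrap u by apply: val_inj; rewrite /= modnDr modn_mod.
  case/orP => h; have hb := gap_below h.
    by have [ab E] := gap_uniq hb ua w0; move: h; rewrite E ab => /andP[].
  by have [ab E] := gap_uniq hb ua w1; move: h; rewrite E ab => /andP[].
exists a; case/andP: ua => pu un; have ua : in_gap a u by apply/andP.
by case: (wrapE ua) => <-; rewrite pu uf ?orbT.
Qed.

Lemma hop_set_valid : row_valid pos_set (hop_set f).
Proof.
apply/forallP => j; apply/andP; split.
  apply/negP => /andP[jH].
  have [a [u [ua uj]]] := gap_ex (ord_pred j).
  have -> : j = wrap u.+1.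
    by rewrite -[LHS]ord_predK -uj -ord_pred_wrap ord_predK.
  move: jH; rewrite -uj (in_hop_set ua) => uf.
  have ua1 : in_gap a u.+1.
    case/andP: ua => pu _; rewrite /in_gap ltnW ?ltnS //=.
    by apply: leq_ltn_trans uf _; case/andP: (fgap a).
  by rewrite (in_pos_set ua1); case/andP: ua => pu _; lia.
apply/implyP; have [a [u [ua <-]]] := gap_ex j; rewrite (in_hop_set ua) (in_pos_set ua).
case: u ua => [|u] ua uf; case/andP: (ua) => pu _; first by rewrite eq_sym -leqn0 pu.
have [//|pu' /=] := eqVneq u.+1 (p a).
have ua' : in_gap a u by apply: gap_below; lia.
by rewrite ord_pred_wrap (in_hop_set ua'); lia.
Qed.

Lemma in_row_out a u : in_gap a u ->
  (wrap u \in row_out pos_set (hop_set f)) = (u == f a :> nat).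
Proof.
move=> ua; rewrite inE (in_pos_set ua) (in_hop_set ua) -leqNgt.
have [/andP[pu _] /andP[pf _]] := (ua, fgap a).
have [E|ne] /= := eqVneq u (p a); first by rewrite E in pu *; rewrite eqn_leq pf.
case: u ne ua pu => [|u] ne ua pu; first by lia.
have ua' : in_gap a u by case/andP: ua => ? ?; apply/andP; lia.
rewrite ord_pred_wrap (in_hop_set ua'); lia.
Qed.

End HopSet.

Lemma hop_set_inj : {in in_gaps &, injective hop_set}.
Proof.
move=> f g fP gP E; apply/ffunP => a; apply: val_inj => /=.
have [fa ga] := (forallP fP a, forallP gP a).
have := in_hop_set fP ga; have := in_hop_set gP fa.
by rewrite -E (in_hop_set fP fa) E (in_hop_set gP ga) !ltnn; case: ltngtP.
Qed.

Lemma hop_set_onto H : row_valid pos_set H -> exists2 f, in_gaps f & hop_set f = H.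
Proof.
move=> /forallP vH.
(* A horizontal edge out of the column just before the next one would enter a vertex already matched
   from below, so the run starting at [p a] has ended by then. *)
have stop a : exists u, (p a <= u)%N && (wrap u \notin H).
  exists (next_pos a).-1; have := next_pos_gt a; have := wrap_next a.
  case: (next_pos a) => [|u] //= uB; rewrite ltnS => -> /=.
  by have /andP[+ _] := vH (wrap u.+1); rewrite uB andbT ord_pred_wrap.
pose q a := ex_minn (stop a).
have qP a : [/\ (p a <= q a)%N, wrap (q a) \notin H &
     forall u, (p a <= u < q a)%N -> wrap u \in H].
  rewrite /q; case: ex_minnP => m /andP[pm mH] mmin; split=> // u /andP[pu um].
  by apply/negP => /negP uH; have := mmin u; rewrite pu uH => /(_ isT); rewrite leqNgt um.
have qgap a : in_gap a (q a).
  have [pq _ _] := qP a; rewrite /in_gap pq /= /q.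
  case: ex_minnP => m _ mmin; have := next_pos_gt a; have := wrap_next a.
  case E : (next_pos a) => [|u] //= uB; rewrite ltnS => pu.
  rewrite ltnS; apply: mmin; rewrite pu /=.
  by have /andP[+ _] := vH (wrap u.+1); rewrite uB andbT ord_pred_wrap.
have q2 a : (q a < n + n)%N.
  by case/andP: (qgap a) => _ h; apply: ltn_trans h (next_pos_lt2 a).
pose f := [ffun a => Ordinal (q2 a)].
have fq a : f a = q a :> nat by rewrite ffunE.
have fP : in_gaps f by apply/forallP => a; rewrite fq.
exists f => //; apply/setP => j; have [a [u [ua <-]]] := gap_ex j.
rewrite (in_hop_set fP ua) fq; have [pq qH qmin] := qP a.
case/andP: (ua) => pu un; have [uq|qu] := ltnP u (q a); first by rewrite qmin ?pu.
(* Strictly inside a gap there is no one from below, so a horizontal edge after the stopping point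
   needs its predecessor. Going back step by step gives an edge at the stopping point itself. *)
apply/esym/negbTE/negP => uH; case/negP: qH.
have [d ud] : exists d, u = (q a + d)%N by exists (u - q a)%N; rewrite subnKC.
elim: d u ud uH ua pu un qu => [|d IH] u ud uH ua pu un qu.
  by rewrite addn0 in ud; rewrite -ud.
rewrite addnS in ud.
have ua' : in_gap a (q a + d)%N by rewrite /in_gap; lia.
apply: (IH (q a + d)%N) => //; try lia.
have /andP[_ /implyP] := vH (wrap u) => /(_ uH).
by rewrite ud ord_pred_wrap -ud (in_pos_set ua) => /orP[/eqP|] //; lia.
Qed.

End Transfer.

(** * Bialternants as eigenvectors of the row transfer *)

Section CyclicDet.
Variable R : comNzRingType.

Lemma det_cyclic_diff k' (C : R) :
  \det (\matrix_(i, j < k'.+1)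
    ((i == j)%:R - (i.+1 == j)%:R - C * ((i == k' :> nat) && (j == 0%N :> nat))%:R)) =
  1 - C.
Proof.
set A := \matrix_(i, j) _; rewrite (expand_det_col _ ord0).
have c0 : cofactor A ord0 ord0 = 1.
  rewrite /cofactor /= expr0 mul1r -det_tr det_trig.
    by rewrite big1 // => i _; rewrite !mxE !lift0 /= eqxx gtn_eqF // andbF mulr0 !subr0.
  apply/is_trig_mxP => i j ij; rewrite !mxE !lift0 /= andbF mulr0 subr0.
  by rewrite (inj_eq lift_inj) -val_eqE /= gtn_eqF // eqSS gtn_eqF ?subr0 // ltnW // ltnS.
have cm : cofactor A ord_max ord0 = 1.
  rewrite /cofactor /= addn0 det_trig.
    rewrite (eq_bigr (fun=> -1)); first by rewrite prodr_const card_ord -expr2 sqrr_sign.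
    move=> i _; rewrite !mxE lift_max lift0 eqxx /= andbF mulr0 subr0.
    by rewrite -val_eqE /= /bump [(k' <= _)%N]leqNgt ltn_ord ltn_eqF // sub0r.
  apply/is_trig_mxP => i j ij; rewrite !mxE lift_max lift0 /= andbF mulr0 subr0.
  rewrite -val_eqE /= /bump [(k' <= _)%N]leqNgt ltn_ord eqSS.
  by rewrite !ltn_eqF ?subr0 // add0n add1n ltnS ltnW.
(* Written as a difference of two indicators, column 0 needs no separate case k' = 0, where the two
   corners coincide. *)
transitivity (\sum_i ((i == ord0)%:R - C * (i == ord_max)%:R) * cofactor A i ord0).
  apply: eq_bigr => i _; congr (_ * _); rewrite !mxE eqxx andbT subr0.
  by [].
under eq_bigr => i _ do rewrite mulrBl.
rewrite sumrB (bigD1 ord0) //= big1 ?addr0 => [|i /negbTE ->]; last by rewrite mul0r.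
rewrite (bigD1 ord_max) //= big1 ?addr0 => [|i /negbTE ->]; last by rewrite mulr0 mul0r.
by rewrite c0 cm !eqxx !mulr1.
Qed.

End CyclicDet.

Section Phi.
Variables (F : fieldType) (n k : nat) (x : 'I_k -> F).

(** The bialternant numerator of B, defined for every set; the default 0 of [nth] is reached only
    when B has fewer than k elements. *)
Definition Phi (B : {set 'I_n}) : F :=
  \det (\matrix_(a, i < k) x i ^+ nth 0%N [seq val j | j <- enum B] a).

Lemma PhiE (r : 'I_k -> nat) (B : {set 'I_n}) : increasing r -> #|B| = k ->
  (forall a, exists2 j, j \in B & j = r a :> nat) ->
  Phi B = \det (\matrix_(a, i < k) x i ^+ r a).
Proof.
move=> ri Bk rB; pose s := [seq val j | j <- enum B].
have ss : size s = k by rewrite size_map -cardE.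
have si : increasing (fun a : 'I_k => nth 0%N s a).
  move=> a b ab; apply: (sorted_ltn_nth ltn_trans) ab; rewrite ?inE ?ss ?ltn_ord //.
  exact: sorted_enum.
have E : r =1 (fun a : 'I_k => nth 0%N s a).
  apply: increasing_eq => // a; have [j jB ja] := rB a.
  have js : val j \in s by apply: map_f; rewrite mem_enum.
  have jk : (index (val j) s < k)%N by rewrite -ss index_mem.
  by exists (Ordinal jk); rewrite /= nth_index.
by congr (\det _); apply/matrixP => a i; rewrite !mxE E.
Qed.

End Phi.

Section Eigen.
Variables (F : fieldType) (n k' : nat).
Local Notation k := k'.+1.
Variables (p : 'I_k -> nat) (x : 'I_k -> F) (c : F).
Hypotheses (p_incr : increasing p) (p_lt : forall a, (p a < n)%N).
Hypotheses (x_pow : forall i, x i ^+ n = c).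
Hypotheses (c_sign : c = (-1) ^+ k').

Local Notation wrap := (wrap p_lt).

Lemma Phi_pos_set : Phi x (pos_set n p) = \det (\matrix_(a, i < k) x i ^+ p a).
Proof.
apply: PhiE => // [|a]; last first.
  by exists (Ordinal (p_lt a)) => //; rewrite inE; apply/existsP; exists a.
have -> : pos_set n p = [set Ordinal (p_lt a) | a : 'I_k].
  apply/setP => j; rewrite inE; apply/existsP/imsetP => [[a /eqP pj]|[a _ ->]].
    by exists a => //; apply: val_inj.
  by exists a.
by rewrite card_imset ?card_ord // => a b /(congr1 val) /(increasing_inj p_incr).
Qed.

Lemma card_row_out f : in_gaps p f -> #|row_out (pos_set n p) (hop_set p f)| = k.
Proof.
move=> fP; have -> : row_out (pos_set n p) (hop_set p f) = [set wrap (f a) | a : 'I_k].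
  apply/setP => j; have [a [u [ua <-]]] := gap_ex p_lt j.
  rewrite (in_row_out p_incr p_lt fP ua); apply/eqP/imsetP => [->|[b _ E]]; first by exists a.
  by have [-> ->] := gap_uniq p_incr ua (forallP fP b) E.
rewrite card_imset ?card_ord // => a b E.
by have [] := gap_uniq p_incr (forallP fP a) (forallP fP b) E.
Qed.

(** Only the last one can wrap around, and it then lands before all the others. Reducing its column
    by n takes the factor c out of its row, and moving that row to the front costs the sign (-1)^k',
    which [c_sign] cancels. *)
Lemma Phi_row_out f : in_gaps p f ->
  Phi x (row_out (pos_set n p) (hop_set p f)) = \det (\matrix_(a, i < k) x i ^+ f a).
Proof.
move=> fP; have fg a : in_gap n p a (f a) := forallP fP a.
have out a : wrap (f a) \in row_out (pos_set n p) (hop_set p f).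
  by rewrite (in_row_out p_incr p_lt fP (fg a)) eqxx.
have f_incr : increasing (fun a => f a) by move=> a b ab; apply: gap_lt ab (fg a) (fg b).
have f_lt (a : 'I_k) : (a < k')%N -> (f a < n)%N.
  move=> ak; case/andP: (fg a) => _ fn; apply: ltn_trans fn _.
  case: (next_posP n p a) => [[b _ ->]|[am _]]; first exact: p_lt.
  by move: ak; rewrite am /= ltnn.
have [fmax|fmax] := ltnP (f ord_max) n.
  apply: PhiE => //; first exact: card_row_out.
  move=> a; exists (wrap (f a)) => //=; rewrite modn_small //.
  have := leq_ord a; rewrite leq_eqVlt => /orP[/eqP ak|]; last exact: f_lt.
  by have -> : a = ord_max by apply: val_inj.
(* The landing columns in increasing order: the wrapped one first, then the others shifted by one
   index. *)
pose r (a : 'I_k) : nat := if unlift ord0 a is Some b then f (lift ord_max b) else (f ord_max - n)%N.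
have r0 : r ord0 = (f ord_max - n)%N by rewrite /r unlift_none.
have rS b : r (lift ord0 b) = f (lift ord_max b) by rewrite /r liftK.
have r0_lt : (r ord0 < p ord0)%N.
  by rewrite r0 ltn_subLR // addnC; case/andP: (fg ord_max); rewrite next_pos_max.
pose s : 'S_k := lift_perm ord_max ord0 1%g.
have -> : \matrix_(a, i < k) x i ^+ f a =
   diag_mx (\row_a (if a == ord_max then c else 1)) *m
     row_perm s (\matrix_(a, i < k) x i ^+ r a).
  apply/matrixP => a i; rewrite mul_diag_mx !mxE /s.
  case: (unliftP ord_max a) => [b ->|->].
    by rewrite lift_perm_lift perm1 rS eq_sym (negbTE (neq_lift _ _)) mul1r.
  by rewrite lift_perm_id eqxx r0 -(x_pow i) -exprD addnC subnK.
rewrite det_mulmx det_diag row_permE det_mulmx det_perm /s odd_lift_perm odd_perm1 /= addbF addbF.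
rewrite signr_odd mulrA big_ord_recr /= mxE eqxx big1 ?mul1r; last first.
  by move=> i _; rewrite mxE -val_eqE /= ltn_eqF.
rewrite c_sign -expr2 sqrr_sign mul1r.
apply: PhiE; last 2 first.
- exact: card_row_out.
- move=> a; case: (unliftP ord0 a) => [b ->|->].
    exists (wrap (f (lift ord_max b))) => //=; rewrite rS modn_small // f_lt //.
    by rewrite lift_max.
  exists (wrap (f ord_max)) => //=; rewrite r0 -[in LHS](subnK fmax) modnDr modn_small //.
  by rewrite -r0; apply: ltn_trans r0_lt _.
move=> a b; case: (unliftP ord0 b) => [b' ->|->] //.
case: (unliftP ord0 a) => [a' ->|->] ab.
  rewrite !rS; apply: f_incr; move: ab; rewrite !lift0 !lift_max; exact: id.
rewrite rS; apply: (leq_trans r0_lt); case/andP: (fg (lift ord_max b')) => + _.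
by apply: leq_trans; apply: p_mono.
Qed.

Variable h : nat -> F.
Hypothesis hrec : forall r, \sum_(j < r.+1) (recip_poly x)`_j * h (r - j)%N = (r == 0%N)%:R.
Hypotheses (x_inj : injective x) (k_le_n : (k <= n)%N).

Lemma gap_sum (R : comNzRingType) (z : R) N u v : (u < v <= N)%N ->
  (\sum_(w < N) (u <= w < v)%N%:R * z ^+ w) * (1 - z) = z ^+ u - z ^+ v.
Proof.
move=> /andP[uv vN].
have uvN : (u <= v.-1 < N)%N by lia.
transitivity ((\sum_(w < N) if (u <= w <= v.-1)%N then z ^+ w else 0) * (1 - z)).
  congr (_ * _); apply: eq_bigr => w _; have -> : (w <= v.-1)%N = (w < v)%N by lia.
  by case: ifP => _; rewrite ?mul1r ?mul0r.
rewrite (@sum_window R N u v.-1 (fun w => z ^+ w)) // mulrC.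
under eq_bigr => s _ do rewrite exprD.
rewrite -big_distrr /= mulrCA -opprB mulNr -subrX1 mulrN mulrBr mulr1 opprB -exprD.
by congr (_ - _ ^+ _); lia.
Qed.

(* Proved with an extra variable 'X, because some 1 - x i may vanish. *)
Lemma sum_gaps_det :
  \sum_(f : {ffun 'I_k -> 'I_(n + n)} | in_gaps p f) \det (\matrix_(a, i < k) x i ^+ f a) =
  (\sum_(r < (n - k).+1) h r) * \det (\matrix_(a, i < k) x i ^+ p a).
Proof.
pose z i : {poly F} := x i *: 'X.
pose U : 'M[{poly F}]_k := \matrix_(a, i) z i ^+ p a.
pose L : 'M[{poly F}]_(k, n + n) := \matrix_(a, u) (in_gap n p a u)%:R.
pose V : 'M[{poly F}]_(n + n, k) := \matrix_(u, i) z i ^+ u.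
pose S := \sum_(f : {ffun 'I_k -> 'I_(n + n)} | in_gaps p f)
   \det (\matrix_(a, i < k) z i ^+ f a).
have detLV : \det (L *m V) = S.
  rewrite det_mulmx_sum [RHS]big_mkcond; apply: eq_bigr => f _ /=.
  rewrite (eq_bigr (fun a => (in_gap n p a (f a))%:R)); last by move=> a _; rewrite mxE.
  have -> : \det (\matrix_(i, j) V (f i) j) = \det (\matrix_(a, i < k) z i ^+ f a).
    by congr (\det _); apply/matrixP => a i; rewrite !mxE.
  case: ifP => [fP|/negbT]; first by rewrite big1 ?mul1r // => a _; rewrite (forallP fP).
  by rewrite negb_forall => /existsP[a /negbTE fa]; rewrite (bigD1 a) //= fa !mul0r.
(* Multiplying column i by [1 - z i] telescopes each gap sum to a difference of two powers of [z i].
   In the last row z_i^n = c X^n leads back to the first position, which gives the matrix of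
   [det_cyclic_diff] with C = c X^n, times [U]. *)
have detD : \det (L *m V) * recip_poly x = (1 - c *: 'X^n) * \det U.
  rewrite -(det_cyclic_diff k') -det_mulmx.
  transitivity (\det ((L *m V) *m diag_mx (\row_i (1 - z i)))).
    rewrite det_mulmx det_diag; congr (_ * _).
    by apply: eq_bigr => i _; rewrite mxE.
  congr (\det _); apply/matrixP => a i; rewrite mul_mx_diag !mxE.
  transitivity ((\sum_(w < n + n) (p a <= w < next_pos n p a)%N%:R * z i ^+ w) * (1 - z i)).
    by congr (_ * _); apply: eq_bigr => w _; rewrite !mxE.
  rewrite gap_sum; last by rewrite (next_pos_gt p_incr p_lt) ltnW // (next_pos_lt2 p_lt).
  under eq_bigr => b _ do rewrite !mxE 2!mulrBl.
  rewrite 2!sumrB (bigD1 a) //= big1 => [|b /negbTE ba]; last by rewrite eq_sym ba mul0r.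
  rewrite eqxx mul1r addr0.
  case: (next_posP n p a) => [[b ba ->]|[-> ->]].
    rewrite [X in _ - X - _](bigD1 b) //= ba eqxx mul1r big1 ?addr0 => [|d db]; last first.
      by rewrite -ba val_eqE eq_sym (negbTE db) mul0r.
    rewrite [X in _ - X]big1 ?subr0 // => d _.
    by rewrite (_ : (a == k' :> nat) = false) ?mulr0 ?mul0r //; have := ltn_ord b; lia.
  rewrite [X in _ - X - _]big1 ?subr0 => [|b _]; last by rewrite gtn_eqF ?mul0r.
  rewrite (bigD1 ord0) //= eqxx /= mulr1 big1 ?addr0 => [|b]; last first.
    by rewrite -val_eqE /= => /negbTE ->; rewrite mulr0 mul0r.
  congr (_ - _); rewrite exprD mulrC; congr (_ * _).
  by rewrite /z exprZn x_pow.
(* As a polynomial with constant term 1, [recip_poly x] can be cancelled; the substitution X = 1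
   comes only afterwards. *)
have rp0 : recip_poly x != 0.
  apply/eqP => E; have := linfactors0 x xpredT.
  by rewrite -/(recip_poly x) E coef0 => /eqP; rewrite eq_sym oner_eq0.
have SE : S = (\poly_(r < (n - k).+1) h r) * \det U.
  apply: (mulIf rp0); rewrite -detLV detD -(trunc_gen_mul hrec x_inj k_le_n x_pow) //.
  by rewrite mulrAC.
have ev (r : 'I_k -> nat) : (\det (\matrix_(a, i < k) z i ^+ r a)).[1] =
    \det (\matrix_(a, i < k) x i ^+ r a).
  rewrite -[LHS]/(horner_eval 1 _) -det_map_mx; congr (\det _); apply/matrixP => a i.
  by rewrite !mxE rmorphXn /= /horner_eval /z hornerZ hornerX mulr1.
have := congr1 (fun q : {poly F} => q.[1]) SE.
rewrite hornerM ev horner_poly /S horner_sum => E.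
under eq_bigr => f _ do rewrite -ev.
by rewrite E; congr (_ * _); apply: eq_bigr => r _; rewrite expr1n mulr1.
Qed.

Lemma transfer_eigen :
  \sum_(H : {set 'I_n} | row_valid (pos_set n p) H) Phi x (row_out (pos_set n p) H) =
  (\sum_(r < (n - k).+1) h r) * Phi x (pos_set n p).
Proof.
rewrite Phi_pos_set -sum_gaps_det.
under [RHS]eq_bigr => f fP do rewrite -(Phi_row_out fP).
transitivity (\sum_(H in [set hop_set p f | f in in_gaps p])
   Phi x (row_out (pos_set n p) H)).
  apply: eq_bigl => H; apply/idP/imsetP => [/(hop_set_onto p_incr p_lt)[f fP <-]|[f fP ->]].
    by exists f.
  exact: (hop_set_valid p_incr p_lt).
by rewrite (big_imset _ (hop_set_inj p_incr p_lt)).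
Qed.

End Eigen.

Lemma sum_cons_tuple (T : finType) (V : nmodType) m (P : pred (seq T)) (F : seq T -> V) :
  \sum_(s : m.+1.-tuple T | P s) F s =
  \sum_(x : T) \sum_(s : m.-tuple T | P (x :: s)) F (x :: s).
Proof.
pose g (p : T * m.-tuple T) : m.+1.-tuple T := [tuple of p.1 :: p.2].
rewrite pair_big_dep /= (reindex g) //=.
exists (fun s => (thead s, [tuple of behead s])) => [[x s] _ | s _].
  by congr (_, _); apply: val_inj.
by rewrite /g /= [RHS]tuple_eta.
Qed.

Lemma card_in_seq (T : finType) (M : {set T}) (s : seq T) : uniq s ->
  #|[set e in M | e \in s]| = count (mem M) s.
Proof.
move=> us; have -> : [set e in M | e \in s] = [set e in filter (mem M) s].
  by apply/setP => e; rewrite !inE mem_filter.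
by rewrite cardsE -size_filter; apply/card_uniqP/filter_uniq.
Qed.

(** * Dimers as sequences of rows *)

Section RowPaths.
Variable n : nat.
Implicit Types (B H : {set 'I_n}) (s : seq {set 'I_n}).

Fixpoint path_valid B s : bool :=
  if s is H :: s' then row_valid B H && path_valid (row_out B H) s' else true.

Definition level B s l : {set 'I_n} := foldl (@row_out n) B (take l s).

Lemma level_succ B s l : (l < size s)%N ->
  level B s l.+1 = row_out (level B s l) (nth set0 s l).
Proof. by move=> ls; rewrite /level (take_nth set0) // foldl_rcons. Qed.

Lemma path_validP B s :
  reflect (forall t, (t < size s)%N -> row_valid (level B s t) (nth set0 s t))
    (path_valid B s).
Proof.
elim: s B => [|H s IH] B /=; first by apply: ReflectT.
apply: (iffP andP) => [[v /IH vs] [|t] //= ts|v]; first exact: vs.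
split; first exact: (v 0%N).
by apply/IH => t ts; apply: (v t.+1).
Qed.

(** [G] is an invariant of the levels, later that of having k elements. The eigenvalue equation is
    asked for only when m > 0: the cylinder has height k, and [Phi_eigen] assumes k > 0. *)
Lemma sum_row_paths (R : comNzRingType) (G : pred {set 'I_n}) (Psi : {set 'I_n} -> R) tau m B :
  (forall B' H, G B' -> row_valid B' H -> G (row_out B' H)) ->
  ((0 < m)%N -> forall B', G B' ->
     \sum_(H | row_valid B' H) Psi (row_out B' H) = tau * Psi B') ->
  G B ->
  \sum_(s : m.-tuple {set 'I_n} | path_valid B s) Psi (foldl (@row_out n) B s) =
  tau ^+ m * Psi B.
Proof.
move=> Gout; elim: m B => [|m IH] B Geig GB.
  rewrite expr0 mul1r (eq_bigl (xpred1 [tuple])) ?big_pred1_eq // => s.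
  by rewrite [s]tuple0 /= eqxx.
rewrite (@sum_cons_tuple _ _ _ (path_valid B) (fun s => Psi (foldl (@row_out n) B s))) /=.
rewrite exprSr -mulrA -Geig // big_distrr /= [RHS]big_mkcond; apply: eq_bigr => H _.
case: ifP => [vH|_] /=; last by rewrite big1.
by rewrite IH // => [_|]; [apply: Geig | apply: Gout].
Qed.

End RowPaths.

Section DimerRows.
Variables m n : nat.
Implicit Types (M : {set edge m n}) (B : {set 'I_n}).

Definition vert_set M l : {set 'I_n} := [set j | Vert l j \in M].

Definition horiz_tuple M : m.-tuple {set 'I_n} :=
  [tuple [set j | Horiz t j \in M] | t < m].

Definition below (t : 'I_m) : 'I_m.+1 := widen_ord (leqnSn m) t.
Definition above (t : 'I_m) : 'I_m.+1 := lift ord0 t.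

Lemma covered_D M t j : covered_once M (Dv t j) =
  ((Inner t j \in M) + (Horiz t (ord_pred j) \in M) + (Vert (below t) j \in M) == 1)%N.
Proof.
rewrite /covered_once; pose s := [:: Inner t j; Horiz t (ord_pred j); Vert (below t) j].
have -> : [set e in M | incident (Dv t j) e] = [set e in M | e \in s].
  apply/setP => -[t' j'|t' j'|l j']; rewrite !inE; congr (_ && _).
  - by rewrite orbF.
  - by rewrite orbF; congr (_ && _); rewrite (can2_eq (@ordSK _) (@ord_predK _)).
by rewrite card_in_seq //= addn0 addnA.
Qed.

Lemma covered_U M t j : covered_once M (Uv t j) =
  ((Inner t j \in M) + (Horiz t j \in M) + (Vert (above t) j \in M) == 1)%N.
Proof.
rewrite /covered_once; pose s := [:: Inner t j; Horiz t j; Vert (above t) j].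
have -> : [set e in M | incident (Uv t j) e] = [set e in M | e \in s].
  apply/setP => -[t' j'|t' j'|l j']; rewrite !inE; congr (_ && _).
  - by rewrite orbF.
  - by rewrite orbF.
by rewrite card_in_seq //= addn0 addnA.
Qed.

(** The covering conditions at D and U of one column, solved for the inner edge i and the upper
    vertical edge b'. Here b is the lower vertical edge, and hp and h are the incoming and outgoing
    horizontal edges. *)
Lemma covered_rowE (i hp b h b' : bool) :
  ((i + hp + b == 1) && (i + h + b' == 1))%N =
  [&& i == ~~ b && ~~ hp, ~~ (hp && b), h ==> b || hp & b' == (b || hp) && ~~ h].
Proof. by case: i; case: hp; case: b; case: h; case: b'. Qed.

Lemma is_dimerP M :
  reflect (forall t : 'I_m,
     [/\ forall j, (Inner t j \in M) = (j \notin vert_set M (below t)) &&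
                      (ord_pred j \notin tnth (horiz_tuple M) t),
         row_valid (vert_set M (below t)) (tnth (horiz_tuple M) t) &
         vert_set M (above t) = row_out (vert_set M (below t)) (tnth (horiz_tuple M) t)])
   (is_dimer M).
Proof.
apply: (iffP forallP) => [dM t|dM t].
  have {}dM j := forallP (dM t) j.
  have {}dM j : [&& (Inner t j \in M) == (Vert (below t) j \notin M) && (Horiz t (ord_pred j) \notin M),
      ~~ ((Horiz t (ord_pred j) \in M) && (Vert (below t) j \in M)),
      (Horiz t j \in M) ==> (Vert (below t) j \in M) || (Horiz t (ord_pred j) \in M) &
      (Vert (above t) j \in M) == ((Vert (below t) j \in M) || (Horiz t (ord_pred j) \in M)) && (Horiz t j \notin M)].
    by rewrite -covered_rowE -covered_D -covered_U.
  rewrite tnth_mktuple; split.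
  - by move=> j; rewrite !inE; case/and4P: (dM j) => /eqP.
  - apply/forallP => j; rewrite !inE; case/and4P: (dM j) => _ -> ->; by [].
  by apply/setP => j; rewrite !inE; case/and4P: (dM j) => _ _ _ /eqP.
apply/forallP => j; rewrite covered_D covered_U covered_rowE.
have := dM t; rewrite tnth_mktuple => -[/(_ j) + /forallP/(_ j) + /setP/(_ j)].
by rewrite !inE => -> /andP[-> ->] ->; rewrite !eqxx.
Qed.

Lemma vert_set_level M l : is_dimer M ->
  vert_set M l = level (vert_set M ord0) (horiz_tuple M) l.
Proof.
move=> /is_dimerP dM; case: l => l lm; elim: l lm => [|l IH] lm.
  by rewrite /level take0; congr vert_set; apply: val_inj.
have lm' : (l < m)%N by [].
rewrite [RHS]level_succ ?size_tuple //.
have -> : nth set0 (horiz_tuple M) l = tnth (horiz_tuple M) (Ordinal lm').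
  by rewrite (tnth_nth set0).
have [_ _] := dM (Ordinal lm').
have -> : above (Ordinal lm') = Ordinal lm by apply: val_inj.
move=> ->; congr (row_out _ _); rewrite -(IH (ltnW lm)).
by congr vert_set; apply: val_inj.
Qed.

Definition dimer_of B (s : m.-tuple {set 'I_n}) : {set edge m n} :=
  [set e | match e with
           | Inner t j => (j \notin level B s t) && (ord_pred j \notin tnth s t)
           | Horiz t j => j \in tnth s t
           | Vert l j => j \in level B s l
           end].

Lemma horiz_dimer_of B s : horiz_tuple (dimer_of B s) = s.
Proof. by apply: eq_from_tnth => t; rewrite tnth_mktuple; apply/setP => j; rewrite !inE. Qed.

Lemma vert_dimer_of B s l : vert_set (dimer_of B s) l = level B s l.
Proof. by apply/setP => j; rewrite !inE. Qed.

Lemma is_dimer_of B s : is_dimer (dimer_of B s) = path_valid B s.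
Proof.
apply/is_dimerP/path_validP => [dM t|vs t].
  rewrite size_tuple => tm; have [_ + _] := dM (Ordinal tm).
  rewrite horiz_dimer_of vert_dimer_of (tnth_nth set0) => h; exact: h.
rewrite horiz_dimer_of !vert_dimer_of; split; first by move=> j; rewrite inE.
  by rewrite (tnth_nth set0); have := vs t; rewrite size_tuple ltn_ord => /(_ isT).
by rewrite /above lift0 level_succ ?size_tuple // (tnth_nth set0).
Qed.

Lemma horizK M : is_dimer M -> dimer_of (vert_set M ord0) (horiz_tuple M) = M.
Proof.
move=> dM; apply/setP => -[t j|t j|l j]; rewrite inE.
- have [-> _ _] := elimT (is_dimerP M) dM t.
  by rewrite (vert_set_level (below t) dM).
- by rewrite tnth_mktuple inE.
by rewrite -vert_set_level // inE.
Qed.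

Lemma sum_dimers (V : nmodType) B (Psi : {set 'I_n} -> V) :
  \sum_(M | is_dimer M && (vert_set M ord0 == B)) Psi (vert_set M ord_max) =
  \sum_(s : m.-tuple {set 'I_n} | path_valid B s) Psi (foldl (@row_out n) B s).
Proof.
rewrite (reindex_onto (dimer_of B) horiz_tuple) /= => [|M /andP[dM /eqP <-]]; last first.
  exact: horizK.
apply: eq_big => s; last first.
  by move=> _; rewrite vert_dimer_of /level /= -[X in take X _](size_tuple s) take_size.
by rewrite is_dimer_of horiz_dimer_of vert_dimer_of /level take0 !eqxx !andbT.
Qed.

Lemma sum_dimers_eigen (R : comNzRingType) (G : pred {set 'I_n}) (Psi : {set 'I_n} -> R) tau B :
  (forall B' H, G B' -> row_valid B' H -> G (row_out B' H)) ->
  ((0 < m)%N -> forall B', G B' ->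
     \sum_(H | row_valid B' H) Psi (row_out B' H) = tau * Psi B') ->
  G B ->
  \sum_(M | is_dimer M && (vert_set M ord0 == B)) Psi (vert_set M ord_max) = tau ^+ m * Psi B.
Proof. by move=> Gout Geig GB; rewrite sum_dimers (sum_row_paths Gout Geig). Qed.

End DimerRows.

Section RowCard.
Variable n : nat.
Implicit Types B H : {set 'I_n}.

(** B and the shift of H by one column are disjoint, their union contains H, and removing H from it
    leaves the ones above. The bound puts the number of horizontal edges in the range 0, ..., n - k
    of the alphas once #|B| = k. *)
Lemma row_out_card B H : row_valid B H ->
  #|row_out B H| = #|B| /\ (#|B| + #|H| <= n)%N.
Proof.
move=> /forallP v; pose S : {set 'I_n} := [set j | ord_pred j \in H].
have SH : #|S| = #|H|.
  have -> : S = [set ordS i | i in H].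
    apply/setP => j; rewrite inE; apply/idP/imsetP => [jH|[i iH ->]].
      by exists (ord_pred j); rewrite ?ord_predK.
    by rewrite ordSK.
  by rewrite card_imset //; apply: (can_inj (@ordSK n)).
have BS : B :&: S = set0.
  by apply/setP => j; rewrite !inE andbC; have /andP[/negbTE] := v j.
have cBS : #|B :|: S| = (#|B| + #|H|)%N by rewrite cardsU BS cards0 subn0 SH.
split; last by rewrite -cBS -[X in (_ <= X)%N]card_ord max_card.
have -> : row_out B H = (B :|: S) :\: H by apply/setP => j; rewrite !inE andbC.
rewrite cardsD; have /setIidPr -> : H \subset B :|: S.
  by apply/subsetP => j jH; rewrite !inE; have /andP[_ /implyP/(_ jH)] := v j.
by rewrite cBS addnK.
Qed.

End RowCard.

(** * Spanning by Schubert classes *)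

Section ElementaryPieri.
Variables (R : comNzRingType) (k : nat) (e h : nat -> R).
Hypothesis e0 : e 0%N = 1.
Hypothesis e_gt : forall j, (k < j)%N -> e j = 0.
Hypothesis eh : forall r, \sum_(j < r.+1) (-1) ^+ j * e j * h (r - j)%N = (r == 0%N)%:R.

Definition rowdet (r : 'I_k -> nat) : R := \det (\matrix_(a, j < k) shiftrow h (r a) j).

(** A companion matrix: multiplied on the right, it turns the row of index a into the row of index a
    + 1, the new entry h_(a+1) coming from the recurrence [eh]. *)
Definition shiftmx : 'M[R]_k :=
  \matrix_(l, j) if j == 0%N :> nat then (-1) ^+ l * e l.+1 else (l.+1 == j)%:R.

Lemma shiftrow_succ a (j : 'I_k) :
  shiftrow h a.+1 j = \sum_(l < k) shiftrow h a l * shiftmx l j.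
Proof.
case: j => [[|j] jk]; last first.
  rewrite (bigD1 (Ordinal (ltnW jk))) //= mxE /= eqxx mulr1 big1 ?addr0 /shiftrow ?ltnS ?subSS //.
  by move=> l lj; rewrite mxE /= eqSS -val_eqE /= in lj *; rewrite (negbTE lj) mulr0.
rewrite /shiftrow /= subn0; have := eh a.+1.
rewrite big_ord_recl /= e0 expr0 !mul1r subn0 => /eqP; rewrite addr_eq0 => /eqP ->.
pose T l := (if (l <= a)%N then h (a - l)%N else 0) * ((-1) ^+ l * e l.+1).
transitivity (\sum_(l < k + a.+1) T l); last first.
  rewrite (@sum_trunc _ k _ T) ?leq_addr //.
    by apply: eq_bigr => l _; rewrite mxE.
  by move=> l kl; rewrite /T e_gt ?mulr0.
rewrite (@sum_trunc _ a.+1 _ T) ?leq_addl //; last first.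
  by move=> l al; rewrite /T leqNgt al mul0r.
rewrite -sumrN; apply: eq_bigr => l _; rewrite /T -ltnS ltn_ord subSS exprS.
by ring.
Qed.

(* T inverts the superdiagonal part 1 + 'X * (l.+1 == j), so T *m M is triangular. *)
Lemma det_one_shiftmx :
  \det (1%:M + 'X *: map_mx polyC shiftmx) = \sum_(l < k.+1) (e l)%:P * 'X^l.
Proof.
set M := _ + _; pose T := toeplitz (fun m => (- 'X) ^+ m : {poly R}) k.
have -> : \det M = \det (T *m M).
  by rewrite det_mulmx det_toeplitz ?mul1r.
have MSE (i j : 'I_k) : j != 0%N :> nat -> (T *m M) i j = (i == j)%:R.
  case: j => [[|j] jk] //= _; rewrite /M mulmxDr mulmx1 -scalemxAr !mxE.
  rewrite (bigD1 (Ordinal (ltnW jk))) //= !mxE /= eqxx rmorph1 mulr1 big1 ?addr0; last first.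
    move=> l; rewrite -val_eqE /= => lj; rewrite !mxE /= eqSS (negbTE lj).
    by rewrite rmorph0 mulr0.
  rewrite -val_eqE /=; case: (ltngtP (i : nat) j.+1) => [ij|ij|->].
  - rewrite -ltnS ij subSn; last by rewrite -ltnS.
    by rewrite exprS mulNr addNr.
  - by rewrite leqNgt (ltnW ij) mulr0 addr0.
  by rewrite ltnn mulr0 addr0 subnn.
have M00 (i : 'I_k) : i == 0%N :> nat -> (T *m M) i i = \sum_(l < k.+1) (e l)%:P * 'X^l.
  move=> /eqP i0; rewrite /M mulmxDr mulmx1 -scalemxAr !mxE leqnn subnn.
  rewrite big_ord_recl e0 expr0 mulr1; congr (_ + _); rewrite big_distrr /=.
  apply: eq_bigr => l _; rewrite !mxE i0 /= subn0 rmorphM rmorphXn rmorphN1.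
  by rewrite exprNn exprS -[RHS]mul1r -[X in _ = X * _](sqrr_sign {poly R} l); ring.
rewrite det_trig; last first.
  apply/is_trig_mxP => i j ij; rewrite MSE; last by case: (j : nat) ij.
  by rewrite -val_eqE /= ltn_eqF.
case: (posnP k) => [k0|k0].
  have no (i : 'I_k) : False by case: i => i; rewrite k0.
  rewrite big1 => [|i _]; last by case: (no i).
  by rewrite big_ord_recl big1 => [|i _]; [rewrite e0 mulr1 addr0 | case: (no i)].
rewrite (bigD1 (Ordinal k0)) //= M00 // [X in _ * X]big1 ?mulr1 // => i.
by rewrite -val_eqE /= => i0; rewrite MSE // eqxx.
Qed.

(** The Pieri rule for e_i, before vanishing terms are dropped. In det(A (1 + X [shiftmx])) row a is
    the row of index r_a plus X times that of index r_a + 1; multilinearity and [det_one_shiftmx]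
    give the two sides as coefficients of X^i. *)
Lemma rowdet_pieri (r : 'I_k -> nat) i : (i <= k)%N ->
  e i * rowdet r = \sum_(S : {set 'I_k} | #|S| == i) rowdet (fun a => (r a + (a \in S))%N).
Proof.
move=> ik; pose A : 'M[R]_k := \matrix_(a, j) shiftrow h (r a) j.
have E : map_mx polyC A *m (1%:M + 'X *: map_mx polyC shiftmx) =
    map_mx polyC A + \matrix_(a, j) ('X * (shiftrow h (r a).+1 j)%:P).
  rewrite mulmxDr mulmx1 -scalemxAr -map_mxM; congr (_ + _); apply/matrixP => a j.
  by rewrite !mxE shiftrow_succ; congr (_ * _%:P); apply: eq_bigr => l _; rewrite !mxE.
have := congr1 (fun M => \det M) E; rewrite /= det_mulmx det_one_shiftmx det_map_mx.
rewrite det_add_rows => /(congr1 (fun p : {poly R} => p`_i)).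
rewrite mulrC coefMC coef_sum (bigD1 (Ordinal (ik : (i < k.+1)%N))) //= big1 => [|l]; last first.
  by rewrite -val_eqE /= => li; rewrite coefCM coefXn eq_sym (negbTE li) mulr0.
rewrite coefCM coefXn eqxx mulr1 addr0 => ->.
rewrite coef_sum [RHS]big_mkcond; apply: eq_bigr => S _ /=.
pose B := \matrix_(a, j < k) shiftrow h (r a + (a \in S))%N j.
have -> : (\matrix_(a, j) if a \in S then (\matrix_(a, j) ('X * (shiftrow h (r a).+1 j)%:P)) a j
     else (map_mx polyC A) a j) =
   diag_mx (\row_a (if a \in S then 'X else 1)) *m map_mx polyC B.
  apply/matrixP => a j; rewrite mul_diag_mx !mxE.
  by case: ifP => _; rewrite ?addn1 ?addn0 ?mul1r.
rewrite det_mulmx det_diag det_map_mx.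
have -> : \prod_a (\row_a0 (if a0 \in S then 'X else 1)) 0 a = 'X^(#|S|) :> {poly R}.
  rewrite -prodr_const [RHS]big_mkcond; apply: eq_bigr => a _; by rewrite mxE.
rewrite coefMC coefXn eq_sym; case: eqP => _; rewrite ?mul1r ?mul0r //.
Qed.

End ElementaryPieri.

(** * Congruence modulo the quantum relations *)

Section QuotientCongruence.
Variables k n : nat.
Local Notation A := {mpoly {poly int}[k]}.
Implicit Types a b c : A.

Lemma eq_qH_refl a : eq_qH n a a.
Proof. by exists (fun=> 0); rewrite subrr big1 // => i _; rewrite mul0r. Qed.

Lemma eq_qH_trans a b c : eq_qH n a b -> eq_qH n b c -> eq_qH n a c.
Proof.
move=> [u E] [v E']; exists (fun i => u i + v i).
by under eq_bigr => i _ do rewrite mulrDl; rewrite big_split -E -E' /=; ring.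
Qed.

Lemma eq_qHD a b c d : eq_qH n a b -> eq_qH n c d -> eq_qH n (a + c) (b + d).
Proof.
move=> [u E] [v E']; exists (fun i => u i + v i).
by under eq_bigr => i _ do rewrite mulrDl; rewrite big_split -E -E' /=; ring.
Qed.

Lemma eq_qHMl c a b : eq_qH n a b -> eq_qH n (c * a) (c * b).
Proof.
move=> [u E]; exists (fun i => c * u i).
by under eq_bigr => i _ do rewrite -mulrA; rewrite -big_distrr -E /= mulrBr.
Qed.

Lemma eq_qHM a b c d : eq_qH n a b -> eq_qH n c d -> eq_qH n (a * c) (b * d).
Proof.
move=> ab cd; apply: (eq_qH_trans (eq_qHMl a cd)).
by rewrite ![_ * d]mulrC; apply: eq_qHMl.
Qed.

Lemma eq_qH_sum (I : finType) (F G : I -> A) :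
  (forall i, eq_qH n (F i) (G i)) -> eq_qH n (\sum_i F i) (\sum_i G i).
Proof.
by move=> FG; elim/big_rec2: _ => [|i a b _ ab]; [apply: eq_qH_refl | apply: eq_qHD].
Qed.

Lemma eq_qH_prod (I : finType) (F G : I -> A) :
  (forall i, eq_qH n (F i) (G i)) -> eq_qH n (\prod_i F i) (\prod_i G i).
Proof.
by move=> FG; elim/big_rec2: _ => [|i a b _ ab]; [apply: eq_qH_refl | apply: eq_qHM].
Qed.

Lemma eq_qH_det m (M N : 'M[A]_m) :
  (forall i j, eq_qH n (M i j) (N i j)) -> eq_qH n (\det M) (\det N).
Proof.
by move=> MN; apply: eq_qH_sum => s; apply/eq_qHMl/eq_qH_prod.
Qed.

Lemma qrel_eq0 (i : 'I_k) : eq_qH n (qrel n i) 0.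
Proof.
exists (fun j => (j == i)%:R); rewrite subr0 (bigD1 i) //= eqxx mul1r.
by rewrite big1 ?addr0 // => j /negbTE ->; rewrite mul0r.
Qed.

End QuotientCongruence.

Section Span.
Variables k n : nat.
Local Notation A := {mpoly {poly int}[k]}.
Implicit Types mu nu la : part k n.

Definition en (j : nat) : A := qe k j%:Z.
Definition hn (r : nat) : A := qh k r%:Z.

Lemma en0 : en 0 = 1. Proof. by []. Qed.

Lemma enS (i : 'I_k) : en i.+1 = 'X_i.
Proof. by rewrite /en /qe /= valK. Qed.

Lemma en_gt j : (k < j)%N -> en j = 0.
Proof. by case: j => // j kj; rewrite /en /qe /= insubF // ltnNge -ltnS kj. Qed.

Lemma hn_jdet r : hn r = jdet en r.
Proof.
congr (\det _); apply/matrixP => i j; rewrite !mxE.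
case: leqP => ij.
  by rewrite /en; congr (qe k _); lia.
have [d ->] : exists d, 1 - i%:Z + j%:Z = Negz d by exists (i - j.+2)%N; lia.
by [].
Qed.

Lemma hn_rec r : \sum_(j < r.+1) (-1) ^+ j * en j * hn (r - j)%N = (r == 0%N)%:R.
Proof. by under eq_bigr => j _ do rewrite hn_jdet; apply: jdet_conv. Qed.

Lemma det_rev (R : comNzRingType) m (M : 'M[R]_m) :
  \det (\matrix_(i, j) M (rev_ord i) (rev_ord j)) = \det M.
Proof.
have -> : \matrix_(i, j) M (rev_ord i) (rev_ord j) =
    row_perm (perm rev_ord_inj) (col_perm (perm rev_ord_inj) M).
  by apply/matrixP => i j; rewrite !mxE !permE.
rewrite row_permE col_permE !det_mulmx !det_perm odd_permV mulrCA.
by rewrite -expr2 sqrr_sign mulr1.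
Qed.

(** Reversing both rows and columns turns the index la_i - i + j into [pos la i] - j. *)
Lemma schubertE la : schubert la = rowdet hn (pos la).
Proof.
rewrite /schubert -det_rev; congr (\det _); apply/matrixP => i j; rewrite !mxE /shiftrow.
have := ltn_ord i; have := ltn_ord j; rewrite /pos /= => ik jk.
case: leqP => ij; first by rewrite /hn; congr (qh k _); lia.
set z := _ + _; have [d ->] : exists d, z = Negz d.
  by exists (j - (la (rev_ord i) + i)).-1; rewrite /z; lia.
by [].
Qed.

Hypothesis k_le_n : (k <= n)%N.

Definition spanned (a : A) := exists c : part k n -> {poly int}, is_schubert_expansion a c.

Lemma spanned_eq a b : eq_qH n a b -> spanned b -> spanned a.
Proof. by move=> ab [c bc]; exists c; apply: eq_qH_trans bc. Qed.

Lemma spanned0 : spanned 0.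
Proof.
exists (fun=> 0); rewrite /is_schubert_expansion big1 => [|nu _]; first exact: eq_qH_refl.
by rewrite mpolyC0 mul0r.
Qed.

Lemma spannedD a b : spanned a -> spanned b -> spanned (a + b).
Proof.
move=> [c ac] [d bd]; exists (fun nu => c nu + d nu); rewrite /is_schubert_expansion.
under eq_bigr => nu _ do rewrite mpolyCD mulrDl.
by rewrite big_split; apply: eq_qHD.
Qed.

Lemma spannedZ q a : spanned a -> spanned (q%:MP * a).
Proof.
move=> [c ac]; exists (fun nu => q * c nu); rewrite /is_schubert_expansion.
under eq_bigr => nu _ do rewrite mpolyCM -mulrA.
by rewrite -big_distrr; apply: eq_qHMl.
Qed.

Lemma spanned_sign s a : spanned a -> spanned ((-1) ^+ s * a).
Proof.
move=> sa; have -> : (-1) ^+ s = ((-1) ^+ s : {poly int})%:MP :> A.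
  by rewrite rmorphXn rmorphN1.
exact: spannedZ.
Qed.

Lemma spanned_sum (I : finType) (P : pred I) (F : I -> A) :
  (forall i, P i -> spanned (F i)) -> spanned (\sum_(i | P i) F i).
Proof.
by move=> FS; elim/big_rec: _ => [|i a Pi sa]; [apply: spanned0 | apply: spannedD; first exact: FS].
Qed.

Lemma spanned_schubert la : spanned (schubert la).
Proof.
exists (fun nu => (nu == la)%:R); rewrite /is_schubert_expansion (bigD1 la) //= eqxx mul1r.
rewrite big1 ?addr0 => [|nu /negbTE ->]; first exact: eq_qH_refl.
by rewrite mpolyC0 mul0r.
Qed.

Lemma rowdet_ninj (r : 'I_k -> nat) : ~ injective r -> rowdet hn r = 0.
Proof. by move=> nr; rewrite -(det_rows_nuniq (fun a j => shiftrow hn a j) nr). Qed.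

Lemma spanned_rowdet_lt (r : 'I_k -> nat) : (forall a, r a < n)%N -> spanned (rowdet hn r).
Proof.
move=> rn; have [ir|/injectiveP nr] := boolP (injectiveb r); last first.
  by rewrite rowdet_ninj //; apply: spanned0.
have /injectiveP ri := ir.
pose f := [ffun a => Ordinal (rn a)].
have fi : injective f by move=> a b; rewrite !ffunE => -[/ri].
have [nu [s fE]] := ex_pos_perm k_le_n fi.
have -> : rowdet hn r = (-1) ^+ s * schubert nu.
  rewrite schubertE -det_perm -det_mulmx -row_permE; congr (\det _).
  apply/matrixP => a j; rewrite !mxE.
  by have := congr1 val (fE a); rewrite /f ffunE /= => ->.
exact/spanned_sign/spanned_schubert.
Qed.

(** The entries h_n, ..., h_(n-k+1) of the row of index n are exactly the k elements reduced by the
    relations. *)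
Lemma qh_row_period (j : 'I_k) :
  eq_qH n (shiftrow hn n j) (('X : {poly int})%:MP * (-1) ^+ k.+1 * shiftrow hn 0 j).
Proof.
have jk := ltn_ord j; have jn : (j <= n)%N by lia.
have rk : (k - j.+1 < k)%N by lia.
have := qrel_eq0 n (Ordinal rk); rewrite /qrel /= /shiftrow leqn0 jn.
have -> : (n - k + (k - j.+1).+1 = n - j)%N by lia.
case: ifP => [/eqP E|E].
  have -> : j = 0%N :> nat by lia.
  rewrite eqxx subn0 /= => h; rewrite {2}/hn (_ : qh k 0%:Z = 1) ?mulr1; last first.
    by rewrite /qh det_mx00.
  have := eq_qHD h (eq_qH_refl n (('X : {poly int})%:MP * (-1) ^+ k.+1)).
  by rewrite add0r exprS mulN1r mulrN addrK.
case: eqP => [j0|_]; first by move: E; rewrite j0 subn0 eqxx.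
by rewrite mulr0.
Qed.

(** When the indices are distinct, at most one equals n, and its row is replaced by a multiple of
    row 0. If 0 already occurs among the others, the new determinant is zero. *)
Lemma spanned_rowdet (r : 'I_k -> nat) : (forall a, r a <= n)%N -> spanned (rowdet hn r).
Proof.
move=> rn; have [ir|/injectiveP nr] := boolP (injectiveb r); last first.
  by rewrite rowdet_ninj //; apply: spanned0.
have /injectiveP ri := ir; have [a ra|no] := pickP (fun a => r a == n); last first.
  by apply: spanned_rowdet_lt => a; rewrite ltn_neqAle rn andbT; apply/negbT/no.
pose r' b := if b == a then 0%N else r b.
pose q : A := ('X : {poly int})%:MP * (-1) ^+ k.+1.
apply: (@spanned_eq _ (q * rowdet hn r')).
  have -> : q * rowdet hn r' = \det (diag_mx (\row_b (if b == a then q else 1)) *m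
      \matrix_(b, j < k) shiftrow hn (r' b) j).
    rewrite det_mulmx det_diag (bigD1 a) //= mxE eqxx big1 ?mulr1 // => b /negbTE ba.
    by rewrite mxE ba.
  apply: eq_qH_det => b j; rewrite mul_diag_mx !mxE /r'.
  case: eqP => [->|_]; last by rewrite mul1r; apply: eq_qH_refl.
  by rewrite (eqP ra); apply: qh_row_period.
rewrite /q -mulrA mulrC -mulrA; apply: spanned_sign; rewrite mulrC; apply: spannedZ.
apply: spanned_rowdet_lt => b; rewrite /r'; case: eqP => [_|/eqP ba].
  by have := ltn_ord a; lia.
rewrite ltn_neqAle rn andbT; apply: contra ba => /eqP rb.
by apply/eqP/ri; rewrite rb (eqP ra).
Qed.

Lemma spannedX (i : 'I_k) a : spanned a -> spanned ('X_i * a).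
Proof.
move=> [c ac]; apply: (spanned_eq (eq_qHMl _ ac)); rewrite big_distrr.
apply: spanned_sum => nu _ /=; rewrite mulrCA; apply: spannedZ.
rewrite schubertE -enS (rowdet_pieri en0 en_gt hn_rec _ (ltn_ord i)).
apply: spanned_sum => S _; apply: spanned_rowdet => b.
by have := pos_lt k_le_n nu b; case: (b \in S); lia.
Qed.

Lemma spannedM a b : spanned b -> spanned (a * b).
Proof.
elim/mpolyind: a b => [|q m a _ _ IH] b sb; first by rewrite mul0r; apply: spanned0.
rewrite mulrDl; apply: spannedD; last exact: IH.
rewrite -mul_mpolyC -mulrA; apply: spannedZ; rewrite mpolyXE_id.
elim/big_rec: _ => [|i f _ IHf]; first by rewrite mul1r.
rewrite -mulrA; elim: (m i) => [|d IHd]; first by rewrite expr0 mul1r.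
by rewrite exprS -mulrA; apply: spannedX.
Qed.

(** All later statements about the chosen coordinates go through this property. *)
Lemma schubert_coordP mu la :
  is_schubert_expansion (schubert mu * schubert la)
    (schubert_coord (schubert mu * schubert la) : part k n -> {poly int}).
Proof. by apply: epsilon_spec; apply/spannedM/spanned_schubert. Qed.

End Span.

(** * Evaluation at tuples of roots *)

Section Evaluation.
Variables (k n : nat) (x : 'I_k -> algC) (q : algC).
Hypotheses (k_le_n : (k <= n)%N) (x_inj : injective x).
Hypothesis x_pow : forall i, x i ^+ n = (-1) ^+ k.+1 * q.
Local Notation A := {mpoly {poly int}[k]}.
Implicit Types mu nu la : part k n.

Definition evq : {rmorphism {poly int} -> algC} := horner_eval q \o map_poly intr.

Definition evp : {rmorphism A -> algC} :=
  mmap evq (fun i : 'I_k => (-1) ^+ i.+1 * (recip_poly x)`_i.+1).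

Lemma evp_en j : evp (en k j) = (-1) ^+ j * (recip_poly x)`_j.
Proof.
case: j => [|j]; first by rewrite en0 rmorph1 linfactors0 mul1r.
have [jk|kj] := ltnP j k.
  by rewrite (enS (Ordinal jk)) /evp /= mmapX mmap1U.
rewrite en_gt ?ltnS // rmorph0 nth_default ?mulr0 //.
by apply: leq_trans (size_recip_poly x) _.
Qed.

Definition hx r := evp (hn k r).

Lemma hx_rec r : \sum_(j < r.+1) (recip_poly x)`_j * hx (r - j)%N = (r == 0%N)%:R.
Proof.
have := congr1 evp (hn_rec k r); rewrite rmorph_sum rmorph_nat => <-.
apply: eq_bigr => j _; rewrite !rmorphM rmorph_sign evp_en mulrA; congr (_ * _).
by rewrite -expr2 sqrr_sign mul1r.
Qed.

Lemma evp_qrel (i : 'I_k) : evp (qrel n i) = 0.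
Proof.
have k0 : (0 < k)%N by apply: leq_ltn_trans (ltn_ord i).
rewrite /qrel; case: eqP => [E|/eqP ne].
  rewrite E rmorphD rmorphM rmorph_sign /= -/(hx n).
  rewrite (h_period hx_rec x_inj x_pow k0) mmapC /evq /= /horner_eval map_polyX hornerX.
  by rewrite exprS; ring.
apply: (h_vanish hx_rec x_inj k_le_n x_pow); have := ltn_ord i; lia.
Qed.

Lemma evp_eq_qH a b : eq_qH n a b -> evp a = evp b.
Proof.
move=> [c E]; apply/eqP; rewrite -subr_eq0 -rmorphB E rmorph_sum big1 // => i _.
by rewrite rmorphM evp_qrel mulr0.
Qed.

Lemma evp_schubert la :
  evp (schubert la) = \det (\matrix_(a, j < k) shiftrow hx (pos la a) j).
Proof.
rewrite schubertE -det_map_mx; congr (\det _); apply/matrixP => a j.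
by rewrite !mxE /shiftrow; case: ifP => _; rewrite ?rmorph0.
Qed.

Lemma evp_schubert_det la :
  evp (schubert la) * \det (\matrix_(a, i < k) x i ^+ a) =
  \det (\matrix_(a, i < k) x i ^+ pos la a).
Proof.
rewrite -(det_shiftrow hx_rec (fun a : 'I_k => a)) (det_shiftrow_id hx_rec) mul1r.
by rewrite evp_schubert (det_shiftrow hx_rec).
Qed.

Lemma det_points_neq0 : \det (\matrix_(a, i < k) x i ^+ a) != 0.
Proof.
rewrite -(det_shiftrow hx_rec (fun a : 'I_k => a)) (det_shiftrow_id hx_rec) mul1r.
exact: (det_eigmx_neq0 hx_rec x_inj).
Qed.

Lemma evp_schubertM mu la :
  evp (schubert mu) * evp (schubert la) =
  \sum_(nu : part k n) (map_poly intr (schubert_coord (schubert mu * schubert la) nu)).[q]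
     * evp (schubert nu).
Proof.
rewrite -rmorphM (evp_eq_qH (schubert_coordP k_le_n mu la)) rmorph_sum.
by apply: eq_bigr => nu _; rewrite rmorphM /= mmapC.
Qed.

Lemma cauchy_points :
  (\sum_(r < (n - k).+1) hx r) ^+ k =
  \sum_(la : part k n) (schur1 la)%:~R * evp (schubert la).
Proof.
rewrite (cauchy_ones k_le_n); last by move=> r; apply: (h_vanish hx_rec x_inj k_le_n x_pow).
by apply: eq_bigr => la _; rewrite evp_schubert.
Qed.

End Evaluation.

Lemma roots_of_sign k n : (0 < n)%N ->
  exists2 w : 'I_n -> algC, injective w & forall j, w j ^+ n = (-1) ^+ k.
Proof.
move=> n0; have [z zP] := C_prim_root_exists n0.
pose u : algC := n.-root ((-1) ^+ k); have un : u ^+ n = (-1) ^+ k by apply: rootCK.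
have u0 : u != 0.
  by apply/eqP => E; move: un; rewrite E expr0n gtn_eqF // => /eqP; rewrite eq_sym signr_eq0.
exists (fun j : 'I_n => u * z ^+ j) => [i j /(mulfI u0) /eqP|j].
  by rewrite (eq_prim_root_expr zP) !modn_small // => /eqP/val_inj.
by rewrite exprMn un -exprM mulnC exprM (prim_expr_order zP) expr1n mulr1.
Qed.

(** * Independence of bialternants on tuples of nodes *)

Section Independence.
Variables (k n : nat) (F : fieldType) (w : 'I_n -> F).
Hypotheses (k_le_n : (k <= n)%N) (w_inj : injective w).

(** The rows of [Y] are the columns of the inverse Vandermonde matrix at the positions of [rho], so
    [Y *m X nu] records coincidences of positions and its determinant isolates nu = rho.
    Cauchy-Binet writes this determinant as a combination of bialternants at tuples of nodes, the
    non-injective ones being zero. *)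
Lemma positions_free (c : part k n -> F) :
  (forall g : {ffun 'I_k -> 'I_n}, injective g ->
     \sum_nu c nu * \det (\matrix_(a, i < k) w (g i) ^+ pos nu a) = 0) ->
  forall nu, c nu = 0.
Proof.
move=> c0 rho; pose V := Vandermonde n (\row_j w j).
have VU : V \in unitmx.
  rewrite unitmxE unitfE det_Vandermonde; apply/prodf_neq0 => i _; apply/prodf_neq0 => j ij.
  by rewrite !mxE subr_eq0; apply: contraTneq ij => /w_inj ->; rewrite ltnn.
pose Y : 'M[F]_(k, n) := \matrix_(b, j) invmx V j (opos k_le_n rho b).
pose X (nu : part k n) : 'M[F]_(n, k) := \matrix_(j, a) w j ^+ pos nu a.
have YX (nu : part k n) : \det (Y *m X nu) = (nu == rho)%:R.
  have YXE : Y *m X nu = \matrix_(b, a) (opos k_le_n nu a == opos k_le_n rho b)%:R.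
    apply/matrixP => b a; have /matrixP/(_ (opos k_le_n nu a) (opos k_le_n rho b)) := mulmxV VU.
    rewrite !mxE => <-; apply: eq_bigr => j _; rewrite !mxE mulrC; congr (_ * _).
  rewrite YXE; case: eqP => [->|ne].
    rewrite [X in \det X](_ : _ = 1%:M) ?det1 //; apply/matrixP => b a.
    by rewrite !mxE (inj_eq (@opos_inj _ _ k_le_n rho)) eq_sym.
  have [b nb] : exists b, opos k_le_n rho b \notin pset nu.
    apply/existsP; rewrite -negb_forall; apply: contra_notN ne => /forallP sub.
    apply/(pset_inj k_le_n)/esym/eqP; rewrite eqEcard !(card_pset k_le_n) leqnn andbT.
    by apply/subsetP => j; rewrite (pset_image k_le_n rho) => /imsetP[b _ ->].
  rewrite (expand_det_row _ b) big1 // => a _; rewrite mxE.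
  rewrite (_ : (opos k_le_n nu a == opos k_le_n rho b) = false) ?mul0r //.
  by apply: contraNF nb => /eqP <-; rewrite (pset_image k_le_n nu) imset_f.
have E : \sum_nu c nu * \det (Y *m X nu) = c rho.
  rewrite (bigD1 rho) //= big1 ?addr0 => [|nu /negbTE ne]; last by rewrite YX ne mulr0.
  by rewrite YX eqxx mulr1.
rewrite -E; under eq_bigr => nu _ do rewrite det_mulmx_sum big_distrr.
rewrite exchange_big big1 //= => g _.
transitivity ((\prod_i Y i (g i)) * \sum_nu c nu * \det (\matrix_(a, i < k) w (g i) ^+ pos nu a)).
  rewrite big_distrr; apply: eq_bigr => nu _ /=; rewrite mulrCA; congr (_ * (_ * _)).
  by rewrite -det_tr; congr (\det _); apply/matrixP => a i; rewrite !mxE.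
have [gi|/injectiveP ng] := boolP (injectiveb g); first by rewrite c0 ?mulr0 //; apply/injectiveP.
rewrite [X in _ * X]big1 ?mulr0 // => nu _; rewrite -det_tr [X in _ * X](_ : _ = 0) ?mulr0 //.
rewrite -(det_rows_nuniq (fun j a => w j ^+ pos nu a) ng).
by congr (\det _); apply/matrixP => a i; rewrite !mxE.
Qed.

End Independence.

(** * Grading and counting *)

Section Grading.
Variables (k n : nat).
Hypotheses (k_le_n : (k <= n)%N) (n_gt0 : (0 < n)%N).
Implicit Types mu nu la : part k n.

Lemma sum_pos nu : (\sum_(a < k) pos nu a = psize nu + \sum_(a < k) a)%N.
Proof.
rewrite big_split /= /psize; congr (_ + _)%N.
by rewrite [RHS](reindex_inj rev_ord_inj).
Qed.

Lemma det_scaled_points (F : fieldType) (x : 'I_k -> F) t (r : 'I_k -> nat) :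
  \det (\matrix_(a, i < k) (t * x i) ^+ r a) =
  t ^+ (\sum_a r a) * \det (\matrix_(a, i < k) x i ^+ r a).
Proof.
rewrite -prodrXr; transitivity (\det (diag_mx (\row_a t ^+ r a) *m \matrix_(a, i < k) x i ^+ r a)).
  by congr (\det _); apply/matrixP => a i; rewrite mul_diag_mx !mxE exprMn.
by rewrite det_mulmx det_diag; congr (_ * _); apply: eq_bigr => a _; rewrite mxE.
Qed.

(** Since s_nu(t y) = t^|nu| s_nu(y), the expansions of a product at the points t y, with q = t^n,
    and at y, with q = 1, can be compared term by term through [positions_free]. *)
Lemma schubert_coord_scaling mu la nu t : (0 < t)%N ->
  (schubert_coord (schubert mu * schubert la) nu).[(t ^ n)%:R] * (t ^ psize nu)%:R =
  (t ^ (psize la + psize mu))%:R * (schubert_coord (schubert mu * schubert la) nu).[1].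
Proof.
move=> t0; set C := schubert_coord _; have [w w_inj wn] := roots_of_sign k.+1 n_gt0.
pose T : algC := t%:R; have T0 : T != 0 by rewrite pnatr_eq0 -lt0n.
pose c nu' : algC := (map_poly intr (C nu')).[T ^+ n] * T ^+ psize nu' -
    T ^+ (psize la + psize mu) * (map_poly intr (C nu')).[1].
suff c0 : forall nu', c nu' = 0.
  apply: (@intr_inj algC); apply/eqP; rewrite -subr_eq0; apply/eqP; rewrite -[RHS](c0 nu) /c.
  by rewrite !rmorphM /= -!horner_map /= !natrX !rmorphXn rmorph1 /= !rmorph_nat.
apply: (positions_free k_le_n w_inj) => g g_inj.
pose y i := w (g i); have y_inj : injective y by move=> i j /w_inj/g_inj.
pose x i := T * y i; have x_inj : injective x by move=> i j /(mulfI T0)/y_inj.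
have y_pow i : y i ^+ n = (-1) ^+ k.+1 * 1 by rewrite mulr1 /y wn.
have x_pow i : x i ^+ n = (-1) ^+ k.+1 * T ^+ n by rewrite /x exprMn /y wn mulrC.
pose E := \det (\matrix_(a, i < k) y i ^+ a).
have E0 : E != 0 := det_points_neq0 1 y_inj.
pose s nu' := evp y 1 (schubert nu').
have sE nu' : s nu' * E = \det (\matrix_(a, i < k) w (g i) ^+ pos nu' a).
  exact: evp_schubert_det.
have sx nu' : evp x (T ^+ n) (schubert nu') = T ^+ psize nu' * s nu'.
  have := evp_schubert_det x (T ^+ n) nu'; rewrite !det_scaled_points sum_pos exprD -/E -sE => h.
  have TE : T ^+ (\sum_(a < k) a) * E != 0 by rewrite mulf_neq0 ?expf_neq0.
  by apply: (mulIf TE); rewrite h; ring.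
have h1 : (T ^+ psize mu * s mu) * (T ^+ psize la * s la) =
    \sum_nu' (map_poly intr (C nu')).[T ^+ n] * (T ^+ psize nu' * s nu').
  rewrite -(sx mu) -(sx la) (evp_schubertM k_le_n x_inj x_pow).
  by apply: eq_bigr => nu' _; rewrite (sx nu').
have h2 : s mu * s la = \sum_nu' (map_poly intr (C nu')).[1] * s nu'.
  exact: evp_schubertM k_le_n y_inj y_pow mu la.
transitivity ((\sum_nu' c nu' * s nu') * E).
  by rewrite big_distrl; apply: eq_bigr => nu' _; rewrite -sE mulrA.
clear sx sE; clearbody s C.
suff -> : \sum_nu' c nu' * s nu' = 0 by rewrite mul0r.
transitivity ((T ^+ psize mu * s mu) * (T ^+ psize la * s la) -
    T ^+ (psize la + psize mu) * (s mu * s la)); last by rewrite exprD; ring.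
rewrite h1 h2 big_distrr -sumrB; apply: eq_bigr => nu' _ /=.
by rewrite /c; ring.
Qed.

Lemma schubert_coord_graded mu la nu :
  (schubert_coord (schubert mu * schubert la) nu).[1] =
  if (psize nu <= psize la + psize mu)%N && (n %| psize la + psize mu - psize nu)%N
  then GW la mu nu ((psize la + psize mu - psize nu) %/ n) else 0.
Proof.
rewrite /GW; have := schubert_coord_scaling mu la nu.
set c := schubert_coord _ nu; set N := (psize la + psize mu)%N => sc.
pose p : {poly int} := 'X^(psize nu) * (c \Po 'X^n) - c.[1] *: 'X^N.
have p0 : p = 0.
  apply/eqP; case: eqP => // /eqP pn0.
  (* By the scaling identity every positive integer is a root of [p]; [size p] of them are too many
     for a nonzero polynomial. *)
  pose rs : seq int := [seq (i.+1)%:R | i <- iota 0 (size p)].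
  have := max_poly_roots (rs := rs) pn0; rewrite size_map size_iota ltnn => -> //.
    apply/allP => _ /mapP[i _ ->]; rewrite rootE /p !hornerE horner_comp !hornerXn.
    have := sc i.+1 isT; rewrite !natrX => h.
    by rewrite mulrC h; apply/eqP; ring.
  by rewrite map_inj_uniq ?iota_uniq // => i j /eqP; rewrite eqr_nat => /eqP[].
have := congr1 (fun p' : {poly int} => p'`_N) p0.
rewrite coefB coefXnM coefZ coefXn eqxx mulr1 coef0 => /eqP; rewrite subr_eq0 => /eqP <-.
by rewrite coef_comp_poly_Xn //; case: ltnP => //= _; case: ifP.
Qed.

End Grading.

Lemma Phi_eigen (k n : nat) (x : 'I_k -> algC) (B : {set 'I_n}) : (k <= n)%N -> (0 < k)%N ->
  injective x -> (forall i, x i ^+ n = (-1) ^+ k.+1 * 1) -> #|B| = k ->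
  \sum_(H | row_valid B H) Phi x (row_out B H) = (\sum_(r < (n - k).+1) hx x 1 r) * Phi x B.
Proof.
case: k x => // k x kn _ x_inj x_pow Bk; have [nu <-] := ex_part_set kn Bk.
have -> : pset nu = pos_set n (pos nu).
  apply/setP => j; rewrite (pset_image kn) inE; apply/imsetP/existsP => [[a _ ->]|[a /eqP pj]].
    by exists a => /=.
  by exists a => //; apply: val_inj.
apply: (transfer_eigen (pos_increasing nu) (pos_lt kn nu) x_pow _ (hx_rec x 1) x_inj kn).
by rewrite mulr1 !exprS !mulN1r opprK.
Qed.

Section DimerCount.
Variables (k n : nat).
Hypotheses (k_le_n : (k <= n)%N) (n_gt0 : (0 < n)%N).
Implicit Types mu nu la : part k n.

Lemma card_vert_set m (M : {set edge m n}) l : is_dimer M -> #|vert_set M l| = #|vert_set M ord0|.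
Proof.
move=> dM; have /is_dimerP rows := dM; case: l => l lm; elim: l lm => [|l IH] lm.
  by congr #|pred_of_set (vert_set M _)|; apply: val_inj.
have [_ v out] := rows (Ordinal (lm : (l < m)%N)).
have -> : Ordinal lm = above (Ordinal (lm : (l < m)%N)) by apply: val_inj.
rewrite out (row_out_card v).1 -(IH (ltnW lm)).
by congr #|pred_of_set (vert_set M _)|; apply: val_inj.
Qed.

Lemma has_boundaryE mu nu (M : {set edge k n}) :
  has_boundary mu nu M = (vert_set M ord0 == pset mu) && (vert_set M ord_max == pset nu).
Proof.
apply/forallP/andP => [h|[/eqP/setP b0 /eqP/setP b1] j].
  by split; apply/eqP/setP => j; rewrite !inE; case/andP: (h j) => /eqP e0 /eqP e1.
by have := b0 j; have := b1 j; rewrite !inE => -> ->; rewrite !eqxx.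
Qed.

Lemma in_Gamma mu nu (M : {set edge k n}) :
  (M \in Gamma mu nu) =
  [&& is_dimer M, vert_set M ord0 == pset mu & vert_set M ord_max == pset nu].
Proof.
apply/bigcupP/and3P => [[al _]|[dM b0 b1]].
  by rewrite inE has_boundaryE => /and3P[-> /andP[-> ->]].
have hM t : (nhoriz M t < (n - k).+1)%N.
  have /is_dimerP/(_ t)[_ v _] := dM; have [_] := row_out_card v.
  by rewrite card_vert_set // (eqP b0) card_pset // tnth_mktuple ltnS leq_subRL.
exists [ffun t => Ordinal (hM t)] => //; rewrite inE dM has_boundaryE b0 b1 /=.
by apply/forallP => t; rewrite ffunE.
Qed.

Lemma card_Gamma mu nu :
  #|Gamma mu nu| = (\sum_(al : {ffun 'I_k -> 'I_(n - k).+1}) #|Gamma_al al mu nu|)%N.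
Proof.
rewrite -sum1_card /Gamma partition_disjoint_bigcup.
  by apply: eq_bigr => al _; rewrite sum1_card.
move=> al be; apply: contraR => /pred0Pn[M /= /andP[]].
rewrite !inE => /and3P[_ _ /forallP ha] /and3P[_ _ /forallP hb].
by apply/eqP/ffunP => t; apply: val_inj => /=; rewrite -(eqP (ha t)) (eqP (hb t)).
Qed.

(** Every level of a dimer configuration has k elements, so grouping configurations by their top
    level is grouping them by nu. *)
Lemma Gamma_eigen (x : 'I_k -> algC) mu : injective x ->
  (forall i, x i ^+ n = (-1) ^+ k.+1 * 1) ->
  \sum_(nu : part k n) #|Gamma mu nu|%:R * \det (\matrix_(a, i < k) x i ^+ pos nu a) =
  (\sum_(r < (n - k).+1) hx x 1 r) ^+ k * \det (\matrix_(a, i < k) x i ^+ pos mu a).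
Proof.
move=> x_inj x_pow.
have PhiP nu : Phi x (pset nu) = \det (\matrix_(a, i < k) x i ^+ pos nu a).
  apply: PhiE; [exact: pos_increasing | exact: card_pset | move=> a].
  by exists (opos k_le_n nu a) => //; rewrite (pset_image k_le_n) imset_f.
have out_card (B H : {set 'I_n}) : #|B| == k -> row_valid B H -> #|row_out B H| == k.
  by move=> Bk /row_out_card[-> _].
have eig : (0 < k)%N -> forall B : {set 'I_n}, #|B| == k ->
   \sum_(H | row_valid B H) Phi x (row_out B H) = (\sum_(r < (n - k).+1) hx x 1 r) * Phi x B.
  by move=> k0 B /eqP Bk; apply: Phi_eigen.
rewrite -PhiP -(sum_dimers_eigen out_card eig) ?card_pset //.
rewrite (partition_big (fun M => vert_set M ord_max) (fun B : {set 'I_n} => #|B| == k)) /=; last first.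
  by move=> M /andP[dM /eqP b0]; rewrite card_vert_set // b0 card_pset.
transitivity (\sum_(B : {set 'I_n} | B \in [set pset nu | nu : part k n])
   \sum_(M : {set edge k n} | is_dimer M && (vert_set M ord0 == pset mu) && (vert_set M ord_max == B))
      Phi x (vert_set M ord_max)).
  rewrite big_imset /=; last by move=> a b _ _; apply: pset_inj.
  apply: eq_bigr => nu _; rewrite -PhiP -sum1_card natr_sum big_distrl /=.
  apply: eq_big => M; first by rewrite in_Gamma andbA.
  by rewrite in_Gamma mul1r => /and3P[_ _ /eqP->].
apply: eq_bigl => B; apply/imsetP/eqP => [[nu _ ->]|/(ex_part_set k_le_n)[nu <-]]; first exact: card_pset.
by exists nu.
Qed.

(** At every point with q = 1, tau^k s_mu expands in two ways: by counting dimers, and by the Cauchy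
    identity followed by the quantum products s_mu s_la. [positions_free] then equates the
    coefficients. *)
Lemma card_Gamma_GW mu nu :
  #|Gamma mu nu|%:R = \sum_(la : part k n)
    schur1 la * (schubert_coord (schubert mu * schubert la) nu).[1].
Proof.
have [w w_inj wn] := roots_of_sign k.+1 n_gt0.
pose v la nu' : algC := (map_poly intr (schubert_coord (schubert mu * schubert la) nu')).[1].
pose c nu' : algC := #|Gamma mu nu'|%:R - \sum_(la : part k n) (schur1 la)%:~R * v la nu'.
suff c0 : c nu = 0.
  apply: (@intr_inj algC); apply/eqP; rewrite -subr_eq0; apply/eqP; rewrite -[RHS]c0 /c.
  rewrite rmorph_nat rmorph_sum; congr (_ - _); apply: eq_bigr => la _.
  by rewrite rmorphM /= /v -horner_map /= rmorph1.
apply: (positions_free k_le_n w_inj) => g g_inj.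
pose y i := w (g i); have y_inj : injective y by move=> i j /w_inj/g_inj.
have y_pow i : y i ^+ n = (-1) ^+ k.+1 * 1 by rewrite mulr1 /y wn.
pose s la : algC := evp y 1 (schubert la).
have sE la : \det (\matrix_(a, i < k) y i ^+ pos la a) =
    s la * \det (\matrix_(a, i < k) y i ^+ a).
  exact/esym/evp_schubert_det.
have sM la : s mu * s la = \sum_nu' v la nu' * s nu' := evp_schubertM k_le_n y_inj y_pow mu la.
have tauE : _ = \sum_(la : part k n) (schur1 la)%:~R * s la := cauchy_points k_le_n y_inj y_pow.
have GE := Gamma_eigen mu y_inj y_pow; rewrite {}tauE (sE mu) in GE.
rewrite /c; clearbody v s; under eq_bigr => nu' _ do rewrite mulrBl.
rewrite sumrB [X in X - _]GE; apply/eqP; rewrite subr_eq0; apply/eqP.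
rewrite mulrA big_distrl /=.
transitivity (\sum_la (schur1 la)%:~R * (\sum_nu' v la nu' * s nu') *
    \det (\matrix_(a, i < k) y i ^+ a)).
  by rewrite mulr_suml; apply: eq_bigr => la _; rewrite -sM /= [s mu * _]mulrC !mulrA.
under [RHS]eq_bigr => nu' _ do rewrite (sE nu') big_distrl.
rewrite exchange_big; apply: eq_bigr => la _ /=.
by rewrite -mulrA mulr_suml mulr_sumr; apply: eq_bigr => nu' _ /=; rewrite !mulrA.
Qed.

End DimerCount.

Theorem theorem4 (n k : nat) (n_ge3 : (3 <= n)%N) (k_le_n : (k <= n)%N)
    (mu nu : part k n) :
  #|Gamma mu nu| = (\sum_(al : {ffun 'I_k -> 'I_(n - k).+1})
                      #|Gamma_al al mu nu|)%N /\
  (#|Gamma mu nu|%:R : rat) =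
    \sum_(la : part k n | (psize nu <= psize la + psize mu)%N &&
                          (n %| psize la + psize mu - psize nu)%N)
      (GW la mu nu ((psize la + psize mu - psize nu) %/ n)%N)%:~R *
      \prod_(s in diagram la) ((k%:Z + content s)%:~R / (hook la s)%:~R).
Proof.
split; first exact: card_Gamma.
have n_gt0 : (0 < n)%N by apply: leq_trans n_ge3.
have /(congr1 (fun z => z%:~R : rat)) := card_Gamma_GW k_le_n n_gt0 mu nu.
rewrite rmorph_nat => ->; rewrite rmorph_sum [RHS]big_mkcond; apply: eq_bigr => la _ /=.
rewrite rmorphM /= schubert_coord_graded // hook_content mulrC.
by case: ifP => // _; rewrite mul0r.
Qed.
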